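(* Let $n\ge 2$ agents communicate over an undirected connected weighted graph with Laplacian $L$. Let $f_1,\dots,f_n:\mathbb{R}^d\to\mathbb{R}$ be differentiable with $\|\nabla f_i(x)-\nabla f_i(y)\|\le L_f\|x-y\|$ for all $x,y\in\mathbb{R}^d$, $i\in[n]$, where $L_f>0$. Let $f=\frac1n\sum_{i=1}^n f_i$, assume that $f^*=\min_{x\in\mathbb{R}^d}f(x)$ is finite, and assume that $f$ satisfies the Polyak–Łojasiewicz condition with a (known) constant $\nu>0$: $\frac12\|\nabla f(x)\|^2\ge\nu(f(x)-f^* )$ for all $x\in\mathbb{R}^d$. Let $\mathcal{C}:\mathbb{R}^d\to\mathbb{R}^d$ be a compressor such that, for some real number $p\ge1$ and constant $\varphi\in(0,1]$, $\|\mathcal{C}(x)-x\|_p\le1-\varphi$ for all $x\in\mathbb{R}^d$ with $\|x\|_p\le1$. Let $\{x_{i,k}\}$ be generated by Algorithm 3 (see context) with $\alpha=\kappa_1\beta$, $\beta>\kappa_2$, $\eta\in(0,\hat\kappa_3)$ and $s_k=s_0\gamma^k$, where $\kappa_1,\kappa_2,\hat\kappa_3,s_0$ and $\gamma\in(0,1)$ are positive constants as specified in the context. Let $\bar x_k=\frac1n\sum_{i=1}^n x_{i,k}$. Then, for any $k\in\mathbb{N}_0$, $$\sum_{i=1}^{n}\big(\|x_{i,k}-\bar{x}_k\|^2+f(\bar{x}_k)-f^*\big)=\mathcal{O}(\gamma^{k}),$$ i.e. the left side is at most a constant independent of $k$ times $\gamma^k$.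
   Context: Notation: $\mathbb{N}_0$ is the set of nonnegative integers, $[n]=\{1,\dots,n\}$, $\|\cdot\|_p$ is the $p$-norm and $\|\cdot\|=\|\cdot\|_2$; $\|x\|_M^2=x^\top Mx$; $\otimes$ is the Kronecker product. The graph has symmetric weighted adjacency matrix $A=(a_{ij})$, $a_{ij}\ge0$, $a_{ii}=0$; $(i,j)$ is an edge iff $a_{ij}>0$; $L=(L_{ij})=\mathrm{diag}(\sum_j a_{1j},\dots,\sum_j a_{nj})-A$. $\rho(L)$ is the spectral radius of $L$ and $\rho_2(L)$ its smallest positive eigenvalue. Algorithm 3: positive parameters $\alpha,\beta,\eta$ and a positive scaling sequence $\{s_k\}$. Initialize with arbitrary $x_{i,0}\in\mathbb{R}^d$, $\hat x_{i,-1}=y_{i,-1}=v_{i,0}=\mathbf 0_d$, $q_{i,0}=\mathcal C(x_{i,0}/s_0)$. For $k=0,1,\dots$ and all $i\in[n]$: $\hat x_{i,k}=\hat x_{i,k-1}+s_kq_{i,k}$; $y_{i,k}=y_{i,k-1}+s_kq_{i,k}-s_k\sum_{j=1}^nL_{ij}q_{j,k}$; $x_{i,k+1}=x_{i,k}-\eta\alpha(\hat x_{i,k}-y_{i,k})-\eta(\beta v_{i,k}+\nabla f_i(x_{i,k}))$; $v_{i,k+1}=v_{i,k}+\eta\beta(\hat x_{i,k}-y_{i,k})$; $q_{i,k+1}=\mathcal C((x_{i,k+1}-\hat x_{i,k})/s_{k+1})$. Matrices and vectors: let $\lambda_2\le\dots\le\lambda_n$ be the nonzero eigenvalues of $L$,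 $[\mathbf 1_n/\sqrt n\ \ R]$ an orthogonal matrix with $L=R\,\mathrm{diag}(\lambda_2,\dots,\lambda_n)R^\top$, and $P=\lambda_n^{-1}\frac1n\mathbf 1_n\mathbf 1_n^\top+R\,\mathrm{diag}(\lambda_2^{-1},\dots,\lambda_n^{-1})R^\top$. Put $\boldsymbol P=P\otimes\mathbf I_d$, $\boldsymbol K=(\mathbf I_n-\frac1n\mathbf 1_n\mathbf 1_n^\top)\otimes\mathbf I_d$. Let $\boldsymbol x_0=\mathrm{col}(x_{1,0},\dots,x_{n,0})$, $\boldsymbol v_0=\mathrm{col}(v_{1,0},\dots,v_{n,0})=\mathbf 0$, $\boldsymbol g_0^0=\mathrm{col}(\nabla f_1(\bar x_0),\dots,\nabla f_n(\bar x_0))$, $\bar{\boldsymbol g}_0^0=\mathbf 1_n\otimes\nabla f(\bar x_0)$. Norm constants: $\hat d=d^{1/p-1/2}$, $\tilde d=1$ if $p\in[1,2]$; $\hat d=1$, $\tilde d=d^{1/2-1/p}$ if $p>2$. Constants: $\kappa_4>0$ is any constant; $\kappa_1$ is any constant with $\kappa_1\ge\max\{\frac{9+\kappa_4}{2\rho_2(L)},1\}$; $\kappa_5=\max\{\frac{4+5L_f^2}{\kappa_4},\frac{6}{\rho_2(L)}\}$; $\kappa_6=\frac{8(\kappa_1+1)^2L_f^2}{\kappa_5\rho_2(L)}+\frac{4L_f^2}{\rho_2^2(L)}$; $\kappa_2=\max\{\kappa_5,\sqrt{\kappa_6}\}$. $\epsilon_1=\frac{\alpha}{2}\rho_2(L)-\frac14(9\beta+4+5L_f^2)$,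 $\tilde\epsilon_2=3L_f^2+2\beta^2+1+3\alpha^2\rho^2(L)$, $\epsilon_3=\frac{\beta}{2}-3\rho_2^{-1}(L)$, $\tilde\epsilon_4=2\beta^2\rho(L)+\rho_2^{-1}(L)$, $\epsilon_5=\frac18-\frac{(\alpha+\beta)^2L_f^2}{\beta^5\rho_2(L)}-\frac{L_f^2}{2\beta^2\rho_2^2(L)}$, $\epsilon_6=\frac{(\alpha+\beta)L_f^2}{2\beta^3\rho_2(L)}+\frac{3L_f^2}{4}+\frac{L_f^2}{2\beta^2\rho_2^2(L)}+\frac{L_f}{2}$, $\tilde\epsilon_8=\frac12(\alpha+2\beta)\rho(L)+2\beta$, $\epsilon_{10}=\frac{\alpha\rho_2(L)-\beta}{2\alpha\rho_2(L)}$, $\epsilon_{11}=\max\{\frac12+\frac{\alpha}{\beta},\frac{\alpha\rho_2(L)+\beta}{2\alpha\rho_2(L)}\}$, $c_7=\beta^2+\frac12+\frac{3\alpha^2\rho^2(L)}{2}$, $\hat\epsilon_1=\min\{\epsilon_1,\epsilon_3\}$, $\hat\epsilon_2=\max\{\tilde\epsilon_2,\tilde\epsilon_4\}$. $\kappa_9=\min\{\frac{\hat\epsilon_1}{2\epsilon_{11}},\frac{\nu}{2\epsilon_{11}}\}$, $\kappa_{10}=\big(\tilde\epsilon_8+\frac{c_7\hat\epsilon_1}{\hat\epsilon_2}\big)n\tilde d^2$, $\kappa_7$ is any constant with $\kappa_7>\frac{\kappa_{10}(1-\varphi)^2}{\kappa_9}$, $\kappa_8=\frac12\|\boldsymbol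 x_0\|_{\boldsymbol K}^2+\frac12\big\|\boldsymbol v_0+\frac1\beta\boldsymbol g_0^0\big\|^2_{\frac{\alpha+\beta}{\beta}\boldsymbol P}+\boldsymbol x_0^\top\boldsymbol K\boldsymbol P\big(\boldsymbol v_0+\frac1\beta\boldsymbol g_0^0\big)+\frac1{2\nu}\|\bar{\boldsymbol g}_0^0\|^2$, $\kappa_{13}=4(1+\varphi^{-1})\hat d^2n\tilde d^2\alpha^2\rho^2(L)$, $\kappa_{14}=4(1+\varphi^{-1})\hat d^2(\alpha^2\rho^2(L)+L_f^2)$, $\kappa_{15}=\frac{(\varphi+\varphi^2-\varphi^3)\epsilon_{10}}{\kappa_{13}(1-\varphi)^2\epsilon_{10}+\kappa_{14}\kappa_7}$, $\hat\kappa_3=\min\{\frac{\hat\epsilon_1}{2\hat\epsilon_2},\frac{\epsilon_5}{\epsilon_6},\sqrt{\kappa_{15}}\}$, $\kappa_{11}=1-\eta\kappa_9+\frac{\eta\kappa_{10}(1-\varphi)^2}{\kappa_7}$, $\kappa_{12}=(1+\varphi+\eta^2\kappa_{13})(1-\varphi)^2+\frac{\eta^2\kappa_{14}}{\epsilon_{10}}\kappa_7$. $\gamma$ is any constant in $[\max\{\sqrt{\kappa_{11}},\sqrt{\kappa_{12}}\},1)$ and $s_0$ is any positive constant with $s_0\ge\max\{\sqrt{\kappa_8/\kappa_7},\ \max_{i\in[n]}\|x_{i,0}\|_p\}$. *)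

(* Defs.v *)
From mathcomp Require Import all_boot all_order all_algebra.
From mathcomp Require Import all_classical all_reals all_analysis.
From mathcomp Require Import complex.

Set Implicit Arguments.
Unset Strict Implicit.
Unset Printing Implicit Defensive.

Import Order.TTheory GRing.Theory Num.Theory.
Import numFieldNormedType.Exports.

Local Open Scope classical_set_scope.
Local Open Scope ring_scope.

Section Vectors.
Variable R : realType.

Definition pnorm (d : nat) (p : R) (x : 'cV[R]_d) : R :=
  (\sum_(j < d) `|x j 0| `^ p) `^ p^-1.

(* The norm that MathComp-Analysis puts on matrices is the max norm. It induces
   the usual topology, hence the usual [differentiable], but it is not the norm
   meant in the inequalities below. *)
Definition enorm (d : nat) (x : 'cV[R]_d) : R := pnorm 2 x.

Definition wsqnorm (m : nat) (M : 'M[R]_m) (x : 'cV[R]_m) : R :=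
  (x^T *m M *m x) 0 0.

Definition gradient (d : nat) (f : 'cV[R]_d -> R) (x : 'cV[R]_d) : 'cV[R]_d :=
  \col_(j < d) 'D_(delta_mx j 0) f x.

Definition kron (m n k l : nat) (A : 'M[R]_(m, n)) (B : 'M[R]_(k, l)) :
    'M[R]_(\sum_(i < m) k, \sum_(j < n) l) :=
  \mxblock_(i < m, j < n) (A i j *: B).

Definition stack (n d : nat) (x : 'I_n -> 'cV[R]_d) : 'cV[R]_(\sum_(i < n) d) :=
  \mxcol_(i < n) x i.

Definition avg (n d : nat) (x : 'I_n -> 'cV[R]_d) : 'cV[R]_d :=
  n%:R^-1 *: \sum_(i < n) x i.

Definition avg_fun (n d : nat) (f : 'I_n -> 'cV[R]_d -> R) (x : 'cV[R]_d) : R :=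
  n%:R^-1 * \sum_(i < n) f i x.

Definition is_minimum (T : Type) (f : T -> R) (m : R) : Prop :=
  (exists x, f x = m) /\ (forall x, m <= f x).

Definition compressor (d : nat) (p phi : R) (C : 'cV[R]_d -> 'cV[R]_d) : Prop :=
  forall x, pnorm p x <= 1 -> pnorm p (C x - x) <= 1 - phi.

End Vectors.

Section Graph.
Variables (R : realType) (n : nat).

Definition weighted_graph (A : 'M[R]_n) : Prop :=
  [/\ A^T = A, forall i j, 0 <= A i j & forall i, A i i = 0].

Definition connected_graph (A : 'M[R]_n) : Prop :=
  forall i j : 'I_n, connect [rel k l | 0 < A k l] i j.

Definition laplacian (A : 'M[R]_n) : 'M[R]_n :=
  diag_mx (\row_i \sum_j A i j) - A.

Definition spectral_radius (M : 'M[R]_n) : R :=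
  sup [set ComplexField.Normc.normc z |
       z in [set z : R[i] | eigenvalue (map_mx (real_complex R) M) z]].

Definition min_pos_eigenvalue (M : 'M[R]_n) : R :=
  inf [set a : R | eigenvalue M a /\ 0 < a].

Definition ones : 'cV[R]_n := const_mx 1.

(* Eigenvalues keep their one-based numbering: only [lam 2], ..., [lam n] are
   used, and column [i] of [Q] (i = 0, ..., n - 2) belongs to [lam i.+2]. *)
Definition lam_row (lam : nat -> R) : 'rV[R]_n.-1 := \row_i lam i.+2.

Record spectral_decomposition (L : 'M[R]_n) (lam : nat -> R)
    (Q : 'M[R]_(n, n.-1)) : Prop := SpectralDecomposition {
  lam_sorted : forall i, (2 <= i)%N -> (i < n)%N -> lam i <= lam i.+1;
  lam_neq0 : forall i, (2 <= i <= n)%N -> lam i != 0;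
  basis_orthonormal :
    (row_mx ((Num.sqrt n%:R)^-1 *: ones) Q)^T
      *m row_mx ((Num.sqrt n%:R)^-1 *: ones) Q = 1%:M;
  basis_complete :
    row_mx ((Num.sqrt n%:R)^-1 *: ones) Q
      *m (row_mx ((Num.sqrt n%:R)^-1 *: ones) Q)^T = 1%:M;
  laplacian_diag : L = Q *m diag_mx (lam_row lam) *m Q^T }.

Definition Pmx (lam : nat -> R) (Q : 'M[R]_(n, n.-1)) : 'M[R]_n :=
  (lam n)^-1 *: (n%:R^-1 *: (ones *m ones^T))
  + Q *m diag_mx (lam_row (fun i => (lam i)^-1)) *m Q^T.

Definition Kmx : 'M[R]_n := 1%:M - n%:R^-1 *: (ones *m ones^T).

End Graph.

(* The sequences [xhat] and [y] start at index 0; their values at index -1,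
   which are 0, enter through [prev]. *)
Definition prev (V : nmodType) (u : nat -> V) (k : nat) : V :=
  if k is k'.+1 then u k' else 0.

Record algorithm (R : realType) (n d : nat) (L : 'M[R]_n)
    (f : 'I_n -> 'cV[R]_d -> R) (C : 'cV[R]_d -> 'cV[R]_d)
    (alpha beta eta : R) (s : nat -> R)
    (x v xhat y q : 'I_n -> nat -> 'cV[R]_d) : Prop := Algorithm {
  v_init : forall i, v i 0%N = 0;
  q_init : forall i, q i 0%N = C ((s 0%N)^-1 *: x i 0%N);
  xhat_step : forall i k, xhat i k = prev (xhat i) k + s k *: q i k;
  y_step : forall i k,
    y i k = prev (y i) k + s k *: q i k - s k *: \sum_(j < n) L i j *: q j k;
  x_step : forall i k,
    x i k.+1 = x i k - (eta * alpha) *: (xhat i k - y i k)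
               - eta *: (beta *: v i k + gradient (f i) (x i k));
  v_step : forall i k,
    v i k.+1 = v i k + (eta * beta) *: (xhat i k - y i k);
  q_step : forall i k,
    q i k.+1 = C ((s k.+1)^-1 *: (x i k.+1 - xhat i k)) }.

Section Constants.
Variable R : realType.
Variables (n d : nat) (p phi Lf nu rho rho2 : R).
Variables (alpha beta eta kappa1 kappa4 kappa7 : R).

Definition dhat : R := if p <= 2 then d%:R `^ (p^-1 - 2^-1) else 1.
Definition dtilde : R := if p <= 2 then 1 else d%:R `^ (2^-1 - p^-1).

Definition kappa5 : R :=
  Num.max ((4 + 5 * Lf ^+ 2) / kappa4) (6 / rho2).
Definition kappa6 : R :=
  8 * (kappa1 + 1) ^+ 2 * Lf ^+ 2 / (kappa5 * rho2)
  + 4 * Lf ^+ 2 / rho2 ^+ 2.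
Definition kappa2 : R := Num.max kappa5 (Num.sqrt kappa6).

Definition eps1 : R :=
  alpha / 2 * rho2 - 4^-1 * (9 * beta + 4 + 5 * Lf ^+ 2).
Definition eps2_tilde : R :=
  3 * Lf ^+ 2 + 2 * beta ^+ 2 + 1 + 3 * alpha ^+ 2 * rho ^+ 2.
Definition eps3 : R := beta / 2 - 3 * rho2^-1.
Definition eps4_tilde : R := 2 * beta ^+ 2 * rho + rho2^-1.
Definition eps5 : R :=
  8^-1 - (alpha + beta) ^+ 2 * Lf ^+ 2 / (beta ^+ 5 * rho2)
  - Lf ^+ 2 / (2 * beta ^+ 2 * rho2 ^+ 2).
Definition eps6 : R :=
  (alpha + beta) * Lf ^+ 2 / (2 * beta ^+ 3 * rho2) + 3 * Lf ^+ 2 / 4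
  + Lf ^+ 2 / (2 * beta ^+ 2 * rho2 ^+ 2) + Lf / 2.
Definition eps8_tilde : R := 2^-1 * (alpha + 2 * beta) * rho + 2 * beta.
Definition eps10 : R := (alpha * rho2 - beta) / (2 * alpha * rho2).
Definition eps11 : R :=
  Num.max (2^-1 + alpha / beta) ((alpha * rho2 + beta) / (2 * alpha * rho2)).
Definition c7 : R := beta ^+ 2 + 2^-1 + 3 * alpha ^+ 2 * rho ^+ 2 / 2.
Definition eps1_hat : R := Num.min eps1 eps3.
Definition eps2_hat : R := Num.max eps2_tilde eps4_tilde.

Definition kappa9 : R := Num.min (eps1_hat / (2 * eps11)) (nu / (2 * eps11)).
Definition kappa10 : R :=
  (eps8_tilde + c7 * eps1_hat / eps2_hat) * n%:R * dtilde ^+ 2.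
Definition kappa13 : R :=
  4 * (1 + phi^-1) * dhat ^+ 2 * n%:R * dtilde ^+ 2 * alpha ^+ 2 * rho ^+ 2.
Definition kappa14 : R :=
  4 * (1 + phi^-1) * dhat ^+ 2 * (alpha ^+ 2 * rho ^+ 2 + Lf ^+ 2).
Definition kappa15 : R :=
  (phi + phi ^+ 2 - phi ^+ 3) * eps10
  / (kappa13 * (1 - phi) ^+ 2 * eps10 + kappa14 * kappa7).
Definition kappa3_hat : R :=
  Num.min (eps1_hat / (2 * eps2_hat)) (Num.min (eps5 / eps6) (Num.sqrt kappa15)).
Definition kappa11 : R :=
  1 - eta * kappa9 + eta * kappa10 * (1 - phi) ^+ 2 / kappa7.
Definition kappa12 : R :=
  (1 + phi + eta ^+ 2 * kappa13) * (1 - phi) ^+ 2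
  + eta ^+ 2 * kappa14 / eps10 * kappa7.

End Constants.

(* [x0], [v0], [g0], [gbar0] are stacked vectors; [K], [P] act on them. *)
Definition kappa8 (R : realType) (m : nat) (alpha beta nu : R) (K P : 'M[R]_m)
    (x0 v0 g0 gbar0 : 'cV[R]_m) : R :=
  2^-1 * wsqnorm K x0
  + 2^-1 * wsqnorm (((alpha + beta) / beta) *: P) (v0 + beta^-1 *: g0)
  + (x0^T *m K *m P *m (v0 + beta^-1 *: g0)) 0 0
  + (2 * nu)^-1 * enorm gbar0 ^+ 2.

(* Main.v *)
Require Import Defs.
From mathcomp Require Import all_boot all_order all_algebra.
From mathcomp Require Import all_classical all_reals all_analysis.
From mathcomp Require Import complex ring lra.

Set Implicit Arguments.
Unset Strict Implicit.
Unset Printing Implicit Defensive.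

Import Order.TTheory GRing.Theory Num.Theory.
Import numFieldNormedType.Exports.

Local Open Scope ring_scope.

(** Since [xhat - y = L xhat], the algorithm is a primal-dual gradient iteration
    perturbed by the compression error [e = x - xhat]. In the eigenbasis of [L] it
    decouples into scalar recursions. With [w = v + g0 / beta], [g0] the gradients
    at the average, each mode carries the quadratic energy
    [x^2/2 + (1 + alpha/beta)/2 * w^2/lam + x*w/lam], whose sum, together with the
    consensus part of [w] and the gap [f - f^*], is a Lyapunov function [V].
    Descent lemma and Polyak-Lojasiewicz inequality give
    [V_(k+1) <= (1 - eta*kappa9) V_k + eta * c * |e_k|^2], [c] the first factor of [kappa10].
    Simultaneously [|x_k - xhat_(k-1)|_p <= s_k], which keeps the argument of the
    compressor in the unit ball, and [V_k <= kappa7 s_k^2] propagate: the first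
    costs the factor [kappa12 <= gamma^2], the second [kappa11 <= gamma^2]. *)

(** * One eigenmode: the quadratic energy under a single step *)

Section Mode.
Variable R : realFieldType.

(** The compressor is controlled only on the unit ball, and there only by the absolute error
    [1 - phi]; nothing bounds the compression error until the innovation is known to fit into the
    ball of radius [s k]. The innovation depends on the step just made, which is bounded only
    through the energy, and the energy estimate needs the compression error. Hence neither half of
    the invariant can be proved alone. The halves also live in different norms: [dtilde] is the
    price of a p-norm error in the Euclidean energy, [dhat] the price of a Euclidean step in the
    p-norm.

    Four dissipations are available: [x ^+ 2] and [w ^+ 2 / lam] in the modes, the squared gradient
    of [f] and the squared mean step from the descent lemma. The gradient mismatch is charged to
    [x ^+ 2], the drift of [g0] to the mean step, the consensus part of [w] and the gap to the
    gradient. Only the compression error stays unpaid; it is the additive term in the bound on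
    [V]. *)

Lemma young (c a b : R) : 0 < c -> a * b <= c * a ^+ 2 + b ^+ 2 / (4 * c).
Proof.
move=> c0; rewrite -subr_ge0.
have -> : c * a ^+ 2 + b ^+ 2 / (4 * c) - a * b = (2 * c * a - b) ^+ 2 / (4 * c).
  by field; rewrite gt_eqF.
by rewrite divr_ge0 ?sqr_ge0 // mulr_ge0 // ltW.
Qed.

(** With [k1 = al / be], the weight [1 + k1] is the one for which the products [x * w] cancel in the
    first-order change. The term [x * w / lam] produces the dissipation [- be * w ^+ 2 / lam], which
    the two squares alone would not give. *)
Definition mode_energy (k1 lam x w : R) : R :=
  x ^+ 2 / 2 + (1 + k1) / 2 * (w ^+ 2 / lam) + x * w / lam.

Variables (al be lam r r2 : R).
Hypotheses (r2_gt0 : 0 < r2) (r2_lam : r2 <= lam) (lam_r : lam <= r).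
Hypotheses (be_gt0 : 0 < be) (be_al : be <= al) (be_allam : be <= al * lam).

Let lam_gt0 : 0 < lam. Proof. exact: lt_le_trans r2_lam. Qed.
Let al_gt0 : 0 < al. Proof. exact: lt_le_trans be_al. Qed.

Lemma sqr_div_lam2 (w : R) : w ^+ 2 / lam ^+ 2 <= r2^-1 * (w ^+ 2 / lam).
Proof.
have -> : w ^+ 2 / lam ^+ 2 = lam^-1 * (w ^+ 2 / lam).
  by field; rewrite gt_eqF.
apply: ler_wpM2r; first by rewrite divr_ge0 ?sqr_ge0 ?ltW.
by rewrite lef_pV2 ?posrE.
Qed.

(** A completed square. It spends a quarter of the dissipation of [w]; the product [w * e] takes
    another quarter in [mode_first_order]. The consensus direction needs the same bound. *)
Lemma wt_bound (w t : R) :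
  (1 + al / be) * w * t / (lam * be) <=
   be / 4 * (w ^+ 2 / lam) + (al + be) ^+ 2 / (be ^+ 5 * r2) * t ^+ 2.
Proof.
have l0 := gt_eqF lam_gt0; have b0 := gt_eqF be_gt0.
have st := sqr_ge0 t.
have a1 : (1 + al / be) * w * t / (lam * be) <=
     be / 4 * (w ^+ 2 / lam) + (al + be) ^+ 2 / (be ^+ 5 * lam) * t ^+ 2.
  rewrite -subr_ge0.
  have -> : be / 4 * (w ^+ 2 / lam) + (al + be) ^+ 2 / (be ^+ 5 * lam) * t ^+ 2
    - (1 + al / be) * w * t / (lam * be)
    = be / lam * (w / 2 - (al + be) * t / be ^+ 3) ^+ 2.
    by field; rewrite l0 b0.
  by rewrite mulr_ge0 ?sqr_ge0 ?divr_ge0 // ltW.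
apply: (le_trans a1); rewrite lerD2l ler_wpM2r // ler_wpM2l ?sqr_ge0 //.
by rewrite lef_pV2 ?posrE ?mulr_gt0 ?exprn_gt0 // ler_pM2l ?exprn_gt0.
Qed.

(** The left side is the coefficient of [eta] in the energy after one step, with the products
    [x * w] already cancelled. The charges [1] on [x ^+ 2] and [r2^-1] on [w ^+ 2 / lam], left by
    the products with [h] and [t], are beaten later by taking [be] large. *)
Lemma mode_first_order (x e w h t : R) :
  - (al * lam) * x * (x - e) + be * x * (x - e) - x * h - be * w * e
   + (1 + al / be) * w * t / (lam * be) + x * t / (lam * be)
   - be * w ^+ 2 / lam - w * h / lam
  <= (- (al * r2) / 2 + 5 / 4 * be + 1) * x ^+ 2
     + (al * r / 2 + be * r + be) * e ^+ 2
     + (- be / 2 + r2^-1) * (w ^+ 2 / lam) + 3 / 4 * h ^+ 2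
     + ((2 * be ^+ 2 * r2 ^+ 2)^-1 + (al + be) ^+ 2 / (be ^+ 5 * r2)) * t ^+ 2.
Proof.
have l0 := gt_eqF lam_gt0; have b0 := gt_eqF be_gt0; have r0 := gt_eqF r2_gt0.
have sx := sqr_ge0 x; have se := sqr_ge0 e; have sw := sqr_ge0 w; have st := sqr_ge0 t.
have i1 : - (al * lam) * x * (x - e) <= - (al * r2) / 2 * x ^+ 2 + al * r / 2 * e ^+ 2.
  have a1 : al * lam * (x * e) <= al * lam * (2^-1 * x ^+ 2 + 2^-1 * e ^+ 2).
    rewrite ler_pM2l ?mulr_gt0 // -subr_ge0.
    have -> : 2^-1 * x ^+ 2 + 2^-1 * e ^+ 2 - x * e = (x - e) ^+ 2 / 2 by field.
    by rewrite divr_ge0 ?sqr_ge0.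
  have a2 : al * r2 * x ^+ 2 <= al * lam * x ^+ 2 by rewrite ler_wpM2r // ler_pM2l.
  have a3 : al * lam * e ^+ 2 <= al * r * e ^+ 2 by rewrite ler_wpM2r // ler_pM2l.
  lra.
have i2 : be * x * (x - e) <= 5 / 4 * be * x ^+ 2 + be * e ^+ 2.
  have : 0 <= be * (x / 2 + e) ^+ 2 by rewrite mulr_ge0 ?sqr_ge0 ?ltW.
  lra.
have i3 : - x * h <= x ^+ 2 / 2 + h ^+ 2 / 2 by have := sqr_ge0 (x + h); lra.
have i4 : - be * w * e <= be / 4 * (w ^+ 2 / lam) + be * r * e ^+ 2.
  (* Splitting [w / lam] against [e], then multiplying by [be * lam], makes the charges come out as
     [w ^+ 2 / lam] and [lam * e ^+ 2]. *)
  have a1 : - (w / lam) * e <= (w / lam) ^+ 2 / 4 + e ^+ 2.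
    by have := sqr_ge0 (w / lam / 2 + e); lra.
  have a2 : be * lam * (- (w / lam) * e) <= be * lam * ((w / lam) ^+ 2 / 4 + e ^+ 2).
    by rewrite ler_pM2l ?mulr_gt0.
  have a3 : be * lam * e ^+ 2 <= be * r * e ^+ 2 by rewrite ler_wpM2r // ler_pM2l.
  have e1 : be * lam * (- (w / lam) * e) = - be * w * e by field; rewrite l0.
  have e2 : be * lam * ((w / lam) ^+ 2 / 4 + e ^+ 2) =
    be / 4 * (w ^+ 2 / lam) + be * lam * e ^+ 2 by field; rewrite l0.
  lra.
have i5 := wt_bound w t.
have i6 : x * t / (lam * be) <= x ^+ 2 / 2 + (2 * be ^+ 2 * r2 ^+ 2)^-1 * t ^+ 2.
  have a1 : x * t / (lam * be) <= x ^+ 2 / 2 + (2 * be ^+ 2 * lam ^+ 2)^-1 * t ^+ 2.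
    rewrite -subr_ge0.
    have -> : x ^+ 2 / 2 + (2 * be ^+ 2 * lam ^+ 2)^-1 * t ^+ 2 - x * t / (lam * be)
      = (x - t / (lam * be)) ^+ 2 / 2 by field; rewrite l0 b0.
    by rewrite divr_ge0 ?sqr_ge0.
  apply: (le_trans a1); rewrite lerD2l ler_wpM2r //.
  rewrite lef_pV2 ?posrE ?mulr_gt0 ?exprn_gt0 // ler_pM2l ?mulr_gt0 ?exprn_gt0 //.
  by rewrite lerXn2r // nnegrE ltW.
have i7 : - w * h / lam <= r2^-1 * (w ^+ 2 / lam) + h ^+ 2 / 4.
  have := sqr_div_lam2 w; have := sqr_ge0 (w / lam + h / 2).
  have -> : (w / lam + h / 2) ^+ 2 = w ^+ 2 / lam ^+ 2 + w * h / lam + h ^+ 2 / 4.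
    by field; rewrite l0.
  lra.
lra.
Qed.

(** The left side is the energy of the increment itself, the coefficient of [eta ^+ 2]. The
    hypothesis [be <= al] removes the mixed terms in [u ^+ 2], and [be <= al * lam] bounds the
    factor [al * lam - be] by [al * lam]. *)
Lemma mode_second_order (x e w h t : R) (u := x - e) :
  (al * lam * u + be * w + h) ^+ 2 / 2
   + (1 + al / be) / (2 * lam) * (be * lam * u + t / be) ^+ 2
   - (al * lam * u + be * w + h) * (be * lam * u + t / be) / lam
  <= (9 / 4 * al ^+ 2 * r ^+ 2 + 3 / 2 * be ^+ 2 + 1) * (x ^+ 2 + e ^+ 2)
     + (2 * be ^+ 2 * r + r2^-1) * (w ^+ 2 / lam) + 15 / 4 * h ^+ 2
     + (3 / 4 + (2 * be ^+ 2 * r2 ^+ 2)^-1 + (al + be) / (2 * be ^+ 3 * r2)) * t ^+ 2.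
Proof.
have l0 := gt_eqF lam_gt0; have b0 := gt_eqF be_gt0; have r0 := gt_eqF r2_gt0.
have st := sqr_ge0 t; have sh := sqr_ge0 h.
have -> : (al * lam * u + be * w + h) ^+ 2 / 2
   + (1 + al / be) / (2 * lam) * (be * lam * u + t / be) ^+ 2
   - (al * lam * u + be * w + h) * (be * lam * u + t / be) / lam
   = ((al * lam) ^+ 2 / 2 + be ^+ 2 * lam / 2 - al * be * lam / 2) * u ^+ 2
     + (al * lam - be) * u * (be * w + h) + (be * w + h) ^+ 2 / 2
     + u * t - w * t / lam - h * t / (be * lam) + (al + be) / (2 * be ^+ 3 * lam) * t ^+ 2.
  by field; rewrite l0 b0.
have su : u ^+ 2 <= 2 * (x ^+ 2 + e ^+ 2).
  by have := sqr_ge0 (x + e); rewrite /u; lra.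
have u0 := sqr_ge0 u.
have j1 : ((al * lam) ^+ 2 / 2 + be ^+ 2 * lam / 2 - al * be * lam / 2) * u ^+ 2
   <= 3 / 4 * (al * lam) ^+ 2 * u ^+ 2.
  rewrite ler_wpM2r //.
  have a1 := sqr_ge0 (al * lam).
  have a2 : be * (be * lam) <= be * (al * lam) by rewrite ler_pM2l // ler_pM2r.
  lra.
(* The weight [3 / 8] gives [3 / 4 + 3 / 8 = 9 / 8], which [j8] doubles to [9 / 4]. It leaves
   [1 / 2 + 2 / 3 = 7 / 6] of the square that [j3] splits so that [w] receives exactly the
   [2 * be ^+ 2] allowed by [eps4_tilde]. *)
have j2 : (al * lam - be) * u * (be * w + h) <=
   3 / 8 * (al * lam) ^+ 2 * u ^+ 2 + 2 / 3 * (be * w + h) ^+ 2.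
  have := @young (3 / 8) ((al * lam - be) * u) (be * w + h) ltac:(lra).
  have : (al * lam - be) ^+ 2 * u ^+ 2 <= (al * lam) ^+ 2 * u ^+ 2.
    rewrite ler_wpM2r // lerXn2r ?nnegrE ?subr_ge0 ?mulr_ge0 ?(ltW al_gt0) ?(ltW lam_gt0) //.
    by rewrite lerBlDr lerDl ltW.
  have -> : (be * w + h) ^+ 2 / (4 * (3 / 8)) = 2 / 3 * (be * w + h) ^+ 2 by field.
  rewrite exprMn; lra.
have j3 : 7 / 6 * (be * w + h) ^+ 2 <= 2 * (be * w) ^+ 2 + 14 / 5 * h ^+ 2.
  have := sqr_ge0 (5 * (be * w) - 7 * h).
  have -> : (5 * (be * w) - 7 * h) ^+ 2 = 25 * (be * w) ^+ 2 - 70 * (be * w) * h + 49 * h ^+ 2.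
    by ring.
  lra.
have j4 : u * t <= x ^+ 2 + e ^+ 2 + t ^+ 2 / 2 by have := sqr_ge0 (u - t); lra.
have j5 : - w * t / lam <= r2^-1 * (w ^+ 2 / lam) + t ^+ 2 / 4.
  have := sqr_div_lam2 w; have := sqr_ge0 (w / lam + t / 2).
  have -> : (w / lam + t / 2) ^+ 2 = w ^+ 2 / lam ^+ 2 + w * t / lam + t ^+ 2 / 4.
    by field; rewrite l0.
  lra.
have j6 : - h * t / (be * lam) <= h ^+ 2 / 2 + (2 * be ^+ 2 * r2 ^+ 2)^-1 * t ^+ 2.
  have a1 : - h * t / (be * lam) <= h ^+ 2 / 2 + (2 * be ^+ 2 * lam ^+ 2)^-1 * t ^+ 2.
    rewrite -subr_ge0.
    have -> : h ^+ 2 / 2 + (2 * be ^+ 2 * lam ^+ 2)^-1 * t ^+ 2 - - h * t / (be * lam)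
      = (h + t / (be * lam)) ^+ 2 / 2 by field; rewrite l0 b0.
    by rewrite divr_ge0 ?sqr_ge0.
  apply: (le_trans a1); rewrite lerD2l ler_wpM2r //.
  rewrite lef_pV2 ?posrE ?mulr_gt0 ?exprn_gt0 // ler_pM2l ?mulr_gt0 ?exprn_gt0 //.
  by rewrite lerXn2r // nnegrE ltW.
have j7 : (al + be) / (2 * be ^+ 3 * lam) * t ^+ 2 <= (al + be) / (2 * be ^+ 3 * r2) * t ^+ 2.
  rewrite ler_wpM2r // ler_wpM2l ?addr_ge0 ?(ltW al_gt0) ?(ltW be_gt0) //.
  by rewrite lef_pV2 ?posrE ?mulr_gt0 ?exprn_gt0 // ler_pM2l ?mulr_gt0 ?exprn_gt0.
have j8 : 9 / 8 * (al * lam) ^+ 2 * u ^+ 2 <= 9 / 4 * al ^+ 2 * r ^+ 2 * (x ^+ 2 + e ^+ 2).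
  have a1 : (al * lam) ^+ 2 <= al ^+ 2 * r ^+ 2.
    by rewrite exprMn ler_pM2l ?exprn_gt0 // lerXn2r // nnegrE ltW // (lt_le_trans lam_gt0).
  have : (al * lam) ^+ 2 * u ^+ 2 <= al ^+ 2 * r ^+ 2 * (2 * (x ^+ 2 + e ^+ 2)).
    by apply: ler_pM; rewrite ?sqr_ge0.
  lra.
have j9 : 2 * (be * w) ^+ 2 <= 2 * be ^+ 2 * r * (w ^+ 2 / lam).
  have -> : 2 * (be * w) ^+ 2 = 2 * be ^+ 2 * lam * (w ^+ 2 / lam) by field; rewrite l0.
  apply: ler_wpM2r; first by rewrite divr_ge0 ?sqr_ge0 ?ltW.
  by rewrite ler_pM2l ?mulr_gt0 ?exprn_gt0.
have j10 : 0 <= 3 / 2 * be ^+ 2 * (x ^+ 2 + e ^+ 2).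
  rewrite mulr_ge0 ?addr_ge0 ?sqr_ge0 // mulr_ge0 ?sqr_ge0 //; lra.
lra.
Qed.

Lemma mode_descent (eta x e w h t : R) : 0 <= eta ->
  mode_energy (al / be) lam
    (x - eta * (al * lam * (x - e) + be * w + h))
    (w + eta * (be * lam * (x - e) + t / be))
  <= mode_energy (al / be) lam x w
   + eta * ((- (al * r2) / 2 + 5 / 4 * be + 1) * x ^+ 2
     + (al * r / 2 + be * r + be) * e ^+ 2
     + (- be / 2 + r2^-1) * (w ^+ 2 / lam) + 3 / 4 * h ^+ 2
     + ((2 * be ^+ 2 * r2 ^+ 2)^-1 + (al + be) ^+ 2 / (be ^+ 5 * r2)) * t ^+ 2)
   + eta ^+ 2 * ((9 / 4 * al ^+ 2 * r ^+ 2 + 3 / 2 * be ^+ 2 + 1) * (x ^+ 2 + e ^+ 2)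
     + (2 * be ^+ 2 * r + r2^-1) * (w ^+ 2 / lam) + 15 / 4 * h ^+ 2
     + (3 / 4 + (2 * be ^+ 2 * r2 ^+ 2)^-1 + (al + be) / (2 * be ^+ 3 * r2)) * t ^+ 2).
Proof.
move=> eta0; have l0 := gt_eqF lam_gt0; have b0 := gt_eqF be_gt0.
have := ler_wpM2l eta0 (mode_first_order x e w h t).
have := ler_wpM2l (sqr_ge0 eta) (mode_second_order x e w h t) => /=.
set F1 := (X in eta * X <= _ -> _); set F2 := (X in eta ^+ 2 * X <= _ -> _).
set B1 := (X in _ -> _ <= eta * X -> _); set B2 := (X in _ <= eta ^+ 2 * X -> _).
move=> h2 h1.
(* Exact: the energy is a quadratic form and the step is affine in [eta], so the expansion ends at
   [eta ^+ 2]. *)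
have -> : mode_energy (al / be) lam
    (x - eta * (al * lam * (x - e) + be * w + h))
    (w + eta * (be * lam * (x - e) + t / be))
  = mode_energy (al / be) lam x w + eta * F1 + eta ^+ 2 * F2.
  by rewrite /mode_energy /F1 /F2; field; rewrite l0 b0.
by rewrite lerD // lerD.
Qed.

(** Along the all-ones vector the Laplacian vanishes and [w] moves only with the drift of the
    gradients. Here [lam] will be [lam n], whose inverse is the weight of [Pmx] on that vector. *)
Lemma mean_mode_descent (eta w t : R) : 0 <= eta ->
  (1 + al / be) / 2 * ((w + eta * (t / be)) ^+ 2 / lam)
  <= (1 + al / be) / 2 * (w ^+ 2 / lam)
   + eta * (be / 4 * (w ^+ 2 / lam) + (al + be) ^+ 2 / (be ^+ 5 * r2) * t ^+ 2)
   + eta ^+ 2 * ((al + be) / (2 * be ^+ 3 * r2) * t ^+ 2).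
Proof.
move=> eta0; have l0 := gt_eqF lam_gt0; have b0 := gt_eqF be_gt0.
have h1 := ler_wpM2l eta0 (wt_bound w t).
have h2 : (al + be) / (2 * be ^+ 3 * lam) * t ^+ 2 <= (al + be) / (2 * be ^+ 3 * r2) * t ^+ 2.
  rewrite ler_wpM2r ?sqr_ge0 // ler_wpM2l ?addr_ge0 ?(ltW al_gt0) ?(ltW be_gt0) //.
  by rewrite lef_pV2 ?posrE ?mulr_gt0 ?exprn_gt0 // ler_pM2l ?mulr_gt0 ?exprn_gt0.
have {}h2 := ler_wpM2l (sqr_ge0 eta) h2.
have -> : (1 + al / be) / 2 * ((w + eta * (t / be)) ^+ 2 / lam)
  = (1 + al / be) / 2 * (w ^+ 2 / lam) + eta * ((1 + al / be) * w * t / (lam * be))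
    + eta ^+ 2 * ((al + be) / (2 * be ^+ 3 * lam) * t ^+ 2) by field; rewrite l0 b0.
by rewrite lerD // lerD2l.
Qed.

(** Young's inequality with the weight on [w] set to [al / be / 2], the excess of the energy over
    [w ^+ 2 / lam / 2]. The resulting weight on [x] is the origin of [eps10] and of the second entry
    of [eps11]. *)
Lemma cross_term_bound (x w : R) :
  `|x * w / lam| <= be / (2 * al * r2) * x ^+ 2 + al / be / 2 * (w ^+ 2 / lam).
Proof.
have l0 := gt_eqF lam_gt0; have b0 := gt_eqF be_gt0; have r0 := gt_eqF r2_gt0.
have a0 := gt_eqF al_gt0.
have := ler_wpM2l (ltW (divr_gt0 (mulr_gt0 al_gt0 r2_gt0) be_gt0)) (sqr_div_lam2 w).
have -> : al * r2 / be * (r2^-1 * (w ^+ 2 / lam)) = 2 * (al / be / 2 * (w ^+ 2 / lam)).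
  by field; rewrite l0 b0 r0.
have pos (s : R) : 0 <= be / (2 * al * r2) * (x + s * (al * r2 / be * w / lam)) ^+ 2.
  by rewrite mulr_ge0 ?sqr_ge0 // ltW // divr_gt0 // ?mulr_gt0.
have expand s : s ^+ 2 = 1 -> be / (2 * al * r2) * (x + s * (al * r2 / be * w / lam)) ^+ 2
  = be / (2 * al * r2) * x ^+ 2 + s * (x * w / lam) + al * r2 / be * (w ^+ 2 / lam ^+ 2) / 2.
  move=> s2; have -> : al * r2 / be * (w ^+ 2 / lam ^+ 2) / 2
    = s ^+ 2 * (al * r2 / be * (w ^+ 2 / lam ^+ 2) / 2) by rewrite s2 mul1r.
  by field; rewrite l0 b0 r0 a0.
have := pos 1; rewrite expand ?expr1n //; have := pos (- 1); rewrite expand ?sqrrN ?expr1n //.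
move=> h1 h2 h3; rewrite ler_norml; apply/andP; split; lra.
Qed.

Lemma mode_energy_ge (x w : R) :
  (al * r2 - be) / (2 * al * r2) * (x ^+ 2 + w ^+ 2 / lam) <= mode_energy (al / be) lam x w.
Proof.
have b0 := gt_eqF be_gt0; have r0 := gt_eqF r2_gt0; have a0 := gt_eqF al_gt0.
have := cross_term_bound x w; rewrite ler_norml => /andP[h1 _].
have -> : (al * r2 - be) / (2 * al * r2) = 1 / 2 - be / (2 * al * r2).
  by field; rewrite r0 a0.
have wl : 0 <= w ^+ 2 / lam by rewrite divr_ge0 ?sqr_ge0 ?ltW.
have : 0 <= be / (2 * al * r2) * (w ^+ 2 / lam).
  by rewrite mulr_ge0 // ltW // divr_gt0 // !mulr_gt0.
rewrite /mode_energy; lra.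
Qed.

Lemma mode_energy_le (x w : R) :
  mode_energy (al / be) lam x w
  <= (al * r2 + be) / (2 * al * r2) * x ^+ 2 + (2^-1 + al / be) * (w ^+ 2 / lam).
Proof.
have b0 := gt_eqF be_gt0; have r0 := gt_eqF r2_gt0; have a0 := gt_eqF al_gt0.
have := cross_term_bound x w; rewrite ler_norml => /andP[_ h1].
have -> : (al * r2 + be) / (2 * al * r2) = 1 / 2 + be / (2 * al * r2).
  by field; rewrite r0 a0.
rewrite /mode_energy; lra.
Qed.

End Mode.

(** * Signs and sizes of the constants, and the descent of the total energy *)

Section Energy.
Variable R : realType.
Variables (Lf nu rho rho2 alpha beta kappa1 kappa4 : R).
Hypotheses (hLf : 0 < Lf) (hnu : 0 < nu) (hrho2 : 0 < rho2) (hrho : rho2 <= rho).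
Hypotheses (hkappa4 : 0 < kappa4)
  (hkappa1 : Num.max ((9 + kappa4) / (2 * rho2)) 1 <= kappa1)
  (halpha : alpha = kappa1 * beta)
  (hbeta : kappa2 Lf rho2 kappa1 kappa4 < beta).

Notation e1 := (eps1 Lf rho2 alpha beta).
Notation e2 := (eps2_tilde Lf rho alpha beta).
Notation e3 := (eps3 rho2 beta).
Notation e4 := (eps4_tilde rho rho2 beta).
Notation e5 := (eps5 Lf rho2 alpha beta).
Notation e6 := (eps6 Lf rho2 alpha beta).
Notation e1h := (eps1_hat Lf rho2 alpha beta).
Notation e2h := (eps2_hat Lf rho rho2 alpha beta).
Notation e10 := (eps10 rho2 alpha beta).
Notation e11 := (eps11 rho2 alpha beta).
Notation k5 := (kappa5 Lf rho2 kappa4).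

Lemma kappa1_ge1 : 1 <= kappa1.
Proof. by move: hkappa1; rewrite ge_max => /andP[]. Qed.

Lemma kappa1_rho2 : 9 + kappa4 <= 2 * (kappa1 * rho2).
Proof.
move: hkappa1; rewrite ge_max ler_pdivrMr ?mulr_gt0 // => /andP[h _]; lra.
Qed.

Lemma kappa5_gt0 : 0 < k5.
Proof. by rewrite /kappa5 lt_max; apply/orP; right; rewrite divr_gt0. Qed.

Lemma kappa5_beta : k5 < beta.
Proof. by move: hbeta; rewrite /kappa2 gt_max => /andP[]. Qed.

Lemma beta_gt0 : 0 < beta.
Proof. exact: lt_trans kappa5_gt0 kappa5_beta. Qed.

Lemma alpha_gt0 : 0 < alpha.
Proof. by rewrite halpha mulr_gt0 ?beta_gt0 // (lt_le_trans _ kappa1_ge1). Qed.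

Lemma beta_le_alpha : beta <= alpha.
Proof. by rewrite halpha ler_peMl ?kappa1_ge1 // ltW ?beta_gt0. Qed.

Lemma beta_rho2 : 6 < beta * rho2.
Proof.
have := kappa5_beta; rewrite /kappa5 gt_max => /andP[_].
by rewrite ltr_pdivrMr.
Qed.

Lemma beta_kappa4 : 4 + 5 * Lf ^+ 2 < beta * kappa4.
Proof.
have := kappa5_beta; rewrite /kappa5 gt_max => /andP[+ _].
by rewrite ltr_pdivrMr.
Qed.

Lemma alpha_rho2 : 9 / 2 * beta + beta * kappa4 / 2 <= alpha * rho2.
Proof.
rewrite halpha; have := ler_wpM2l (ltW beta_gt0) kappa1_rho2; lra.
Qed.

Lemma beta_alpha_rho2 : beta < alpha * rho2.
Proof.
have := alpha_rho2; have := beta_gt0; have := mulr_gt0 beta_gt0 hkappa4; lra.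
Qed.

Lemma eps1_gt0 : 0 < e1.
Proof. have := alpha_rho2; have := beta_kappa4; rewrite /eps1; lra. Qed.

Lemma eps3_gt0 : 0 < e3.
Proof.
have -> : e3 = (beta * rho2 - 6) / (2 * rho2) by rewrite /eps3; field; rewrite gt_eqF.
by rewrite divr_gt0 ?mulr_gt0 // subr_gt0 beta_rho2.
Qed.

Lemma eps1_hat_gt0 : 0 < e1h.
Proof. by rewrite /eps1_hat lt_min eps1_gt0 eps3_gt0. Qed.

Lemma eps1_hat_le : e1h <= beta / 2.
Proof.
have : e1h <= e3 by rewrite /eps1_hat ge_min lexx orbT.
have : 0 < rho2^-1 by rewrite invr_gt0.
rewrite /eps3; lra.
Qed.

Lemma eps2_hat_ge : 2 * beta ^+ 2 <= e2h.
Proof.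
rewrite /eps2_hat le_max; apply/orP; left; rewrite /eps2_tilde.
have := sqr_ge0 Lf; have : 0 <= alpha ^+ 2 * rho ^+ 2 by rewrite mulr_ge0 ?sqr_ge0.
lra.
Qed.

Lemma eps2_hat_gt0 : 0 < e2h.
Proof. by apply: lt_le_trans eps2_hat_ge; rewrite mulr_gt0 ?exprn_gt0 ?beta_gt0. Qed.

Lemma eps6_gt0 : 0 < e6.
Proof.
have b0 := beta_gt0; have a0 := alpha_gt0; rewrite /eps6.
by rewrite !addr_gt0 // ?divr_gt0 ?mulr_gt0 ?exprn_gt0 ?addr_gt0.
Qed.

Lemma eps10_gt0 : 0 < e10.
Proof.
by rewrite /eps10 divr_gt0 ?mulr_gt0 ?alpha_gt0 // subr_gt0 beta_alpha_rho2.
Qed.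

Lemma eps10_le1 : e10 <= 1.
Proof.
have a0 := alpha_gt0; have b0 := beta_gt0.
rewrite /eps10 ler_pdivrMr ?mulr_gt0 //; have := mulr_gt0 a0 hrho2; lra.
Qed.

Lemma eps11_ge1 : 1 <= e11.
Proof.
rewrite /eps11 le_max; apply/orP; left.
have : 1 <= alpha / beta by rewrite ler_pdivlMr ?beta_gt0 // mul1r beta_le_alpha.
lra.
Qed.

Lemma eps11_gt0 : 0 < e11.
Proof. exact: lt_le_trans eps11_ge1. Qed.

(** Holds because [alpha * rho] exceeds [2 + 5 / 2 * Lf ^+ 2]. It lets the [15 / 4 * H] of the
    second-order estimate fit under [eps2_tilde], where [Lf ^+ 2] has only the factor [3] but
    [alpha ^+ 2 * rho ^+ 2] has slack. *)
Lemma Lf_alpha_rho : Lf ^+ 2 <= alpha ^+ 2 * rho ^+ 2.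
Proof.
rewrite -exprMn lerXn2r ?nnegrE ?mulr_ge0 ?(ltW hLf) ?(ltW alpha_gt0) //.
  by rewrite (le_trans _ hrho) // ltW.
have h1 : alpha * rho2 <= alpha * rho by rewrite ler_pM2l ?alpha_gt0.
have := alpha_rho2; have := beta_kappa4; have := beta_gt0; have := sqr_ge0 (Lf - 2^-1).
have := hLf; lra.
Qed.

(** Lets the summand [beta *: w] of the step be measured by [w ^+ 2 / lam] with the constant that
    the Laplacian part already carries. *)
Lemma beta_alpha_rho : beta ^+ 2 * rho <= alpha ^+ 2 * rho ^+ 2.
Proof.
have r0 : 0 < rho by exact: lt_le_trans hrho.
have b0 := beta_gt0; have k1 := kappa1_ge1.
have -> : alpha ^+ 2 * rho ^+ 2 = beta ^+ 2 * rho * (kappa1 * (kappa1 * rho)).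
  by rewrite halpha; ring.
apply: ler_peMr; first by rewrite mulr_ge0 ?sqr_ge0 // ltW.
have h : 1 <= kappa1 * rho.
  have : kappa1 * rho2 <= kappa1 * rho by rewrite ler_pM2l // (lt_le_trans _ k1).
  have := kappa1_rho2; have := hkappa4; lra.
by rewrite (le_trans h) // ler_peMl // (le_trans _ h).
Qed.

Lemma kappa9_gt0 : 0 < kappa9 Lf nu rho2 alpha beta.
Proof.
by rewrite /kappa9 lt_min !divr_gt0 ?mulr_gt0 ?eps11_gt0 ?eps1_hat_gt0.
Qed.

Lemma c7_ge0 : 0 <= c7 rho alpha beta.
Proof.
rewrite /c7; have := sqr_ge0 beta; have := mulr_ge0 (sqr_ge0 alpha) (sqr_ge0 rho); lra.
Qed.

Lemma kappa10_coef_ge0 : 0 <= eps8_tilde rho alpha beta + c7 rho alpha beta * e1h / e2h.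
Proof.
have r0 : 0 < rho by exact: lt_le_trans hrho.
rewrite addr_ge0 //.
  rewrite /eps8_tilde; have := beta_gt0; have := alpha_gt0 => a0 b0.
  by rewrite ltW // addr_gt0 ?mulr_gt0 ?addr_gt0 ?mulr_gt0 ?invr_gt0.
rewrite divr_ge0 ?(ltW eps2_hat_gt0) // mulr_ge0 ?(ltW eps1_hat_gt0) //.
exact: c7_ge0.
Qed.

Lemma kappa10_ge0 (n d : nat) (p : R) : 0 <= kappa10 n d p Lf rho rho2 alpha beta.
Proof.
by rewrite /kappa10 mulr_ge0 ?sqr_ge0 // mulr_ge0 // kappa10_coef_ge0.
Qed.

Lemma kappa7_gt0 (n d : nat) (p phi kappa7 : R) :
  kappa10 n d p Lf rho rho2 alpha beta * (1 - phi) ^+ 2 / kappa9 Lf nu rho2 alpha beta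
    < kappa7 -> 0 < kappa7.
Proof.
apply: le_lt_trans; rewrite divr_ge0 ?(ltW kappa9_gt0) //.
by rewrite mulr_ge0 ?sqr_ge0 ?kappa10_ge0.
Qed.

(** Keeps the factor of the old energy nonnegative, so that an upper bound for that energy may be
    inserted. The two factors are compared with [beta] and [beta^-1]. *)
Lemma step_kappa9_le1 (eta : R) : 0 <= eta -> eta <= e1h / (2 * e2h) ->
  eta * kappa9 Lf nu rho2 alpha beta <= 1.
Proof.
move=> eta0 eta1; have b0 := beta_gt0.
have h1 : kappa9 Lf nu rho2 alpha beta <= beta.
  rewrite /kappa9 ge_min; apply/orP; left.
  rewrite ler_pdivrMr ?mulr_gt0 ?eps11_gt0 //.
  have := eps1_hat_le; have := ler_wpM2l (ltW b0) eps11_ge1; lra.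
have h2 : eta <= beta^-1.
  apply: (le_trans eta1); rewrite ler_pdivrMr ?mulr_gt0 ?eps2_hat_gt0 //.
  rewrite mulrC ler_pdivlMr //.
  have := ler_wpM2r (ltW b0) eps1_hat_le; have := eps2_hat_ge.
  have := sqr_ge0 beta; lra.
have : eta * kappa9 Lf nu rho2 alpha beta <= beta^-1 * beta.
  by rewrite ler_pM ?(ltW kappa9_gt0).
by rewrite mulVf ?gt_eqF.
Qed.

(* [X], [E], [W], [H], [T] are sums over the nonconstant modes, [Wm], [hm],
   [Tm], [gm] the corresponding contributions of the consensus direction, and
   [F] is [n] times the suboptimality gap. *)
Lemma energy_descent (eta V V' J J' F F' X E W H T Wm hm Tm gm Gm : R) :
  0 < eta -> eta <= e1h / (2 * e2h) -> eta * e6 <= e5 ->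
  0 <= X -> 0 <= E -> 0 <= W -> 0 <= H -> 0 <= T -> 0 <= Wm -> 0 <= hm -> 0 <= Tm ->
  0 <= gm ->
  H + hm <= Lf ^+ 2 * X -> T + Tm <= Lf ^+ 2 * gm ->
  6 * beta * Wm <= Gm -> 2 * nu * F <= Gm ->
  V' <= V
   + eta * ((- (alpha * rho2) / 2 + 5 / 4 * beta + 1) * X
     + (alpha * rho / 2 + beta * rho + beta) * E
     + (- beta / 2 + rho2^-1) * W + 3 / 4 * H
     + ((2 * beta ^+ 2 * rho2 ^+ 2)^-1 + (alpha + beta) ^+ 2 / (beta ^+ 5 * rho2)) * T)
   + eta ^+ 2 * ((9 / 4 * alpha ^+ 2 * rho ^+ 2 + 3 / 2 * beta ^+ 2 + 1) * (X + E)
     + (2 * beta ^+ 2 * rho + rho2^-1) * W + 15 / 4 * H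
     + (3 / 4 + (2 * beta ^+ 2 * rho2 ^+ 2)^-1
        + (alpha + beta) / (2 * beta ^+ 3 * rho2)) * T) ->
  J' <= J + eta * (beta / 4 * Wm + (alpha + beta) ^+ 2 / (beta ^+ 5 * rho2) * Tm)
    + eta ^+ 2 * ((alpha + beta) / (2 * beta ^+ 3 * rho2) * Tm) ->
  F' <= F + eta * (- Gm / 2 - gm / 2 + hm / 2) + eta ^+ 2 * (Lf / 2 * gm) ->
  V' + J' + F' <= V + J + F - eta * (e1h / 2) * (X + W + Wm) - eta * (nu / 2) * F
    + eta * (eps8_tilde rho alpha beta + c7 rho alpha beta * e1h / e2h) * E.
Proof.
move=> eta0 eta1 eta5 X0 E0 W0 H0 T0 Wm0 hm0 Tm0 gm0 HX Tg GW GF hV hJ hF.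
have b0 := beta_gt0; have a0 := alpha_gt0; have eta0' := ltW eta0.
have etah : eta * e2h <= e1h / 2.
  have := eta1; rewrite ler_pdivlMr ?mulr_gt0 ?eps2_hat_gt0 //; lra.
have e1h1 : e1h <= e1 by rewrite /eps1_hat ge_min lexx.
have e1h3 : e1h <= e3 by rewrite /eps1_hat ge_min lexx orbT.
have e2h2 : e2 <= e2h by rewrite /eps2_hat le_max lexx.
have e2h4 : e4 <= e2h by rewrite /eps2_hat le_max lexx orbT.
have i2 : 0 < rho2^-1 by rewrite invr_gt0.
have hL := Lf_alpha_rho.
set c4 := ((2 * beta ^+ 2 * rho2 ^+ 2)^-1 + (alpha + beta) ^+ 2 / (beta ^+ 5 * rho2)) in hV.
set c5 := (alpha + beta) ^+ 2 / (beta ^+ 5 * rho2) in c4 hV hJ.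
set c6 := (alpha + beta) / (2 * beta ^+ 3 * rho2) in hV hJ.
set c3 := (2 * beta ^+ 2 * rho2 ^+ 2)^-1 in c4 hV.
have c30 : 0 <= c3 by rewrite ltW // invr_gt0 !mulr_gt0 // exprn_gt0.
have c50 : 0 <= c5 by rewrite divr_ge0 ?sqr_ge0 // ltW // mulr_gt0 // exprn_gt0.
have c60 : 0 <= c6.
  by rewrite ltW // divr_gt0 ?addr_gt0 ?mulr_gt0 ?exprn_gt0.
(* The step size makes the [eta] part cost at most [e1h / 2], half of the first-order gain; the
   other half remains. [tW] repeats this. *)
have tX : (- (alpha * rho2) / 2 + 5 / 4 * beta + 1) * X + 3 / 4 * H + hm / 2
   + eta * ((9 / 4 * alpha ^+ 2 * rho ^+ 2 + 3 / 2 * beta ^+ 2 + 1) * X + 15 / 4 * H)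
   <= - (e1h / 2) * X.
  have q1 : (9 / 4 * alpha ^+ 2 * rho ^+ 2 + 3 / 2 * beta ^+ 2 + 1) * X + 15 / 4 * H
     <= e2h * X.
    have : (9 / 4 * alpha ^+ 2 * rho ^+ 2 + 3 / 2 * beta ^+ 2 + 1 + 15 / 4 * Lf ^+ 2) * X
       <= e2h * X.
      rewrite ler_wpM2r // (le_trans _ e2h2) // /eps2_tilde.
      have := sqr_ge0 beta; lra.
    lra.
  have q2 := ler_wpM2l eta0' q1.
  have q3 : eta * (e2h * X) <= e1h / 2 * X by rewrite mulrA ler_wpM2r.
  have q4 : e1h * X <= e1 * X by rewrite ler_wpM2r.
  have q5 : 0 <= beta * X by rewrite mulr_ge0 // ltW.
  move: q4; rewrite /eps1; have := mulr_ge0 (sqr_ge0 Lf) X0; lra.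
have tW : (- beta / 2 + rho2^-1) * W + eta * ((2 * beta ^+ 2 * rho + rho2^-1) * W)
   <= - (e1h / 2) * W.
  have q1 : eta * ((2 * beta ^+ 2 * rho + rho2^-1) * W) <= e1h / 2 * W.
    rewrite mulrA ler_wpM2r //; apply: le_trans etah; rewrite ler_wpM2l //.
  have q2 : e1h * W <= e3 * W by rewrite ler_wpM2r.
  have := mulr_ge0 (ltW i2) W0; move: q2; rewrite /eps3; lra.
(* Bounding [eta] by [e1h / (2 * e2h)] in the second-order charge on [E] produces the summand
   [c7 * e1h / e2h] of [kappa10]. *)
have tE : (alpha * rho / 2 + beta * rho + beta) * E
   + eta * ((9 / 4 * alpha ^+ 2 * rho ^+ 2 + 3 / 2 * beta ^+ 2 + 1) * E)
   <= (eps8_tilde rho alpha beta + c7 rho alpha beta * e1h / e2h) * E.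
  rewrite mulrA -mulrDl ler_wpM2r // lerD //.
    by rewrite /eps8_tilde; lra.
  apply: (@le_trans _ _ (eta * (2 * c7 rho alpha beta))).
    rewrite ler_wpM2l // /c7; have := mulr_ge0 (sqr_ge0 alpha) (sqr_ge0 rho).
    have := sqr_ge0 beta; lra.
  have c70 := c7_ge0.
  have -> : c7 rho alpha beta * e1h / e2h = e1h / (2 * e2h) * (2 * c7 rho alpha beta).
    by field; rewrite gt_eqF // eps2_hat_gt0.
  by rewrite ler_wpM2r // mulr_ge0.
(* The charges for the drift and the curvature term all fall on [gm]. With [eta * e6 <= e5] they
   total at most [gm / 8], which the [gm / 2] of the descent lemma covers. *)
have tT : c4 * T + c5 * Tm + eta * ((3 / 4 + c3 + c6) * T + c6 * Tm)
   - gm / 2 + eta * (Lf / 2 * gm) <= 0.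
  have q1 : c4 * T + c5 * Tm <= c4 * (Lf ^+ 2 * gm).
    have := ler_wpM2l (addr_ge0 c30 c50) Tg; rewrite -/c4.
    have := mulr_ge0 c30 Tm0; rewrite /c4; lra.
  have q2 : (3 / 4 + c3 + c6) * T + c6 * Tm <= (3 / 4 + c3 + c6) * (Lf ^+ 2 * gm).
    have c340 : 0 <= 3 / 4 + c3 + c6 by lra.
    have := ler_wpM2l c340 Tg; have := mulr_ge0 c30 Tm0; lra.
  have {}q2 := ler_wpM2l eta0' q2.
  have e5E : e5 = 8^-1 - c4 * Lf ^+ 2.
    by rewrite /eps5 /c4 /c3 /c5; field; rewrite !gt_eqF.
  have e6E : e6 = (3 / 4 + c3 + c6) * Lf ^+ 2 + Lf / 2.
    by rewrite /eps6 /c6 /c3; field; rewrite !gt_eqF.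
  have := ler_wpM2r gm0 eta5; rewrite e5E e6E; lra.
(* Half of [Gm / 2] pays [nu / 2 * F] by the Polyak-Lojasiewicz bound. The other half is worth
   [3 / 2 * beta * Wm], more than the [beta / 4] charged plus the [e1h / 2 <= beta / 4] retained. *)
have tG : beta / 4 * Wm - Gm / 2 <= - (e1h / 2) * Wm - (nu / 2) * F.
  have := ler_wpM2r Wm0 eps1_hat_le; have := mulr_ge0 (ltW b0) Wm0; lra.
have := ler_wpM2l eta0' tX; have := ler_wpM2l eta0' tW; have := ler_wpM2l eta0' tE.
have := ler_wpM2l eta0' tT; have := ler_wpM2l eta0' tG.
rewrite mulr0; clear -hV hJ hF; move: hV hJ hF; rewrite /c4; lra.
Qed.

End Energy.

(** * The p-norm: Minkowski, monotonicity in the exponent, power means *)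

Section PNorm.
Variables (R : realType) (d : nat).
Implicit Types (p q : R) (x y : 'cV[R]_d).

Lemma powR_convex p (t a b : R) : 1 <= p -> 0 <= t <= 1 -> 0 <= a -> 0 <= b ->
  (t * a + (1 - t) * b) `^ p <= t * a `^ p + (1 - t) * b `^ p.
Proof.
move=> p1 /andP[t0 t1] a0 b0.
by apply: (convex_powR p1 (Itv01 t0 t1)); rewrite inE/= in_itv/= andbT.
Qed.

Lemma pnorm_ge0 p x : 0 <= pnorm p x.
Proof. exact: powR_ge0. Qed.

Lemma pnorm_powR p x : 0 < p -> pnorm p x `^ p = \sum_(j < d) `|x j 0| `^ p.
Proof.
move=> p0; rewrite /pnorm -powRrM mulVf ?gt_eqF // powRr1 //.
by apply: sumr_ge0 => j _; exact: powR_ge0.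
Qed.

Lemma pnorm_le p x c : 0 < p -> 0 <= c ->
  \sum_(j < d) `|x j 0| `^ p <= c `^ p -> pnorm p x <= c.
Proof.
move=> p0 c0 h.
have -> : c = (c `^ p) `^ p^-1 by rewrite -powRrM mulfV ?gt_eqF // powRr1.
rewrite /pnorm ge0_ler_powR ?invr_ge0 ?(ltW p0) ?nnegrE ?powR_ge0 //.
by apply: sumr_ge0 => j _; exact: powR_ge0.
Qed.

Lemma pnorm0 p : 0 < p -> pnorm p (0 : 'cV[R]_d) = 0.
Proof.
move=> p0; rewrite /pnorm big1 ?powR0 ?invr_eq0 ?gt_eqF // => j _.
by rewrite mxE normr0 powR0 ?gt_eqF.
Qed.

Lemma pnorm_eq0 p x : 0 < p -> pnorm p x = 0 -> x = 0.
Proof.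
move=> p0 /(congr1 (@powR R ^~ p)); rewrite pnorm_powR // powR0 ?gt_eqF // => h.
apply/colP => j; rewrite !mxE.
have /psumr_eq0P := h; move=> /(_ (fun j _ => powR_ge0 _ _)) /(_ j isT)/eqP.
by rewrite powR_eq0 normr_eq0 => /andP[/eqP].
Qed.

Lemma pnormZ p (c : R) x : 0 < p -> pnorm p (c *: x) = `|c| * pnorm p x.
Proof.
move=> p0; rewrite /pnorm.
under eq_bigr do rewrite mxE normrM powRM ?normr_ge0 //.
rewrite -mulr_sumr powRM ?powR_ge0 //; last by apply: sumr_ge0 => j _; exact: powR_ge0.
by rewrite -powRrM mulfV ?gt_eqF // powRr1.
Qed.

Lemma pnormN p x : 0 < p -> pnorm p (- x) = pnorm p x.
Proof. by move=> p0; rewrite -scaleN1r pnormZ // normrN1 mul1r. Qed.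

(* With [a], [b] the two norms, [(x + y) / (a + b)] is a convex combination of
   [x / a] and [y / b]. *)
Lemma pnormD p x y : 1 <= p -> pnorm p (x + y) <= pnorm p x + pnorm p y.
Proof.
move=> p1; have p0 : 0 < p by exact: lt_le_trans p1.
have := pnorm_ge0 p x; rewrite le_eqVlt => /predU1P[/esym/pnorm_eq0->//|].
  by rewrite pnorm0 // !add0r.
have := pnorm_ge0 p y; rewrite le_eqVlt => /predU1P[/esym/pnorm_eq0->//|].
  by rewrite pnorm0 // !addr0.
have hx := pnorm_powR x p0; have hy := pnorm_powR y p0; move: hx hy.
move: (pnorm p x) (pnorm p y) => a b hx hy b0 a0.
have ab0 : 0 < a + b by exact: addr_gt0.
apply: pnorm_le => //; first exact: ltW.
pose t := a / (a + b).
have t01 : 0 <= t <= 1.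
  by rewrite /t divr_ge0 ?(ltW a0) ?(ltW ab0) //= ler_pdivrMr // mul1r lerDl ltW.
have tE : 1 - t = b / (a + b) by rewrite /t; field; rewrite gt_eqF.
apply: (@le_trans _ _ (\sum_(j < d) (a + b) `^ p *
   (t * (`|x j 0| / a) `^ p + (1 - t) * (`|y j 0| / b) `^ p))).
  apply: ler_sum => j _; rewrite mxE.
  apply: (@le_trans _ _ ((a + b) `^ p *
      (t * (`|x j 0| / a) + (1 - t) * (`|y j 0| / b)) `^ p)).
    rewrite -powRM ?(ltW ab0) //; last first.
      case/andP: t01 => t0 t1.
      by rewrite addr_ge0 // mulr_ge0 ?subr_ge0 // divr_ge0 // ltW.
    have -> : (a + b) * (t * (`|x j 0| / a) + (1 - t) * (`|y j 0| / b))
        = `|x j 0| + `|y j 0|.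
      by rewrite tE /t; field; rewrite !gt_eqF.
    by rewrite ge0_ler_powR ?nnegrE ?ler_normD ?addr_ge0 // ltW.
  by rewrite ler_wpM2l ?powR_ge0 // powR_convex // divr_ge0 // ltW.
rewrite -mulr_sumr ler_piMr ?powR_ge0 // big_split /= -!mulr_sumr.
have unit (z : 'cV[R]_d) c : 0 < c -> c `^ p = \sum_(j < d) `|z j 0| `^ p ->
    \sum_(j < d) (`|z j 0| / c) `^ p = 1.
  move=> c0 hz.
  under eq_bigr do rewrite powRM ?invr_ge0 ?(ltW c0) //.
  by rewrite -mulr_suml -hz -powRM ?invr_ge0 ?(ltW c0) // mulfV ?gt_eqF // powR1.
by rewrite !unit // !mulr1 addrC subrK.
Qed.

Lemma coord_le_pnorm p x j : 0 < p -> `|x j 0| <= pnorm p x.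
Proof.
move=> p0; rewrite leNgt; apply/negP => h.
have : pnorm p x `^ p < `|x j 0| `^ p.
  by rewrite gt0_ltr_powR ?nnegrE ?pnorm_ge0.
rewrite pnorm_powR // (bigD1 j) //= ltNge lerDl sumr_ge0 // => i _.
Qed.

(** No coordinate exceeds the p-norm [N], so each q-th power is at most [N ^ (q - p)] times the p-th
    power; the sum is then [N ^ q]. *)
Lemma pnorm_antitone p q x : 0 < p -> p <= q -> pnorm q x <= pnorm p x.
Proof.
move=> p0 pq; have q0 : 0 < q by exact: lt_le_trans pq.
have := pnorm_ge0 p x; rewrite le_eqVlt => /predU1P[/esym/pnorm_eq0->//|].
  by rewrite !pnorm0.
have := pnorm_powR x p0; have := fun j => coord_le_pnorm x j p0.
move: (pnorm p x) => N hj hN N0.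
apply: pnorm_le => //; first exact: ltW.
have -> : N `^ q = N `^ (q - p) * N `^ p.
  by rewrite -powRD ?(gt_eqF N0) ?implybT // subrK.
rewrite hN mulr_sumr; apply: ler_sum => j _.
have [->|xj0] := eqVneq (`|x j 0|) 0.
  by rewrite powR0 ?gt_eqF // mulr_ge0 ?powR_ge0.
have -> : `|x j 0| `^ q = `|x j 0| `^ (q - p) * `|x j 0| `^ p.
  by rewrite -powRD ?xj0 ?implybT // subrK.
by rewrite ler_wpM2r ?powR_ge0 // ge0_ler_powR ?subr_ge0 ?nnegrE ?(ltW N0).
Qed.

(** As a function of [b ^ q] the left side is concave, and the right side is its tangent at 1. It
    comes from Young's inequality for the exponents [q / p] and [q / (q - p)] with second factor
    1. *)
Lemma powR_young (b p q : R) : 0 <= b -> 0 < p -> p < q ->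
  b `^ p <= p / q * b `^ q + (1 - p / q).
Proof.
move=> b0 p0 pq; have q0 := lt_trans p0 pq.
have qp0 : 0 < q - p by rewrite subr_gt0.
have := @conjugate_powR R (b `^ p) 1 (q / p) (q / (q - p)) (powR_ge0 _ _) ler01.
rewrite !divr_gt0 // => /(_ isT isT).
have -> : (q / p)^-1 + (q / (q - p))^-1 = 1 by field; rewrite !gt_eqF.
move=> /(_ erefl); rewrite mulr1 powR1 -powRrM.
have -> : p * (q / p) = q by field; rewrite gt_eqF.
have -> : b `^ q / (q / p) = p / q * b `^ q by field; rewrite !gt_eqF.
by have -> : 1 / (q / (q - p)) = 1 - p / q by field; rewrite !gt_eqF.
Qed.

Lemma pnorm_power_mean p q x : (0 < d)%N -> 0 < p -> p <= q ->
  pnorm p x <= d%:R `^ (p^-1 - q^-1) * pnorm q x.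
Proof.
move=> d0 p0; rewrite le_eqVlt => /predU1P[<-|pq]; first by rewrite subrr powRr0 mul1r.
have q0 := lt_trans p0 pq.
have D0 : 0 < d%:R :> R by rewrite ltr0n.
have := pnorm_ge0 q x; rewrite le_eqVlt => /predU1P[/esym/pnorm_eq0->//|].
  by rewrite !pnorm0 // mulr0.
have := pnorm_powR x q0; move: (pnorm q x) => N hN N0.
apply: pnorm_le; rewrite ?mulr_ge0 ?powR_ge0 ?(ltW N0) //.
(* Division by the power mean of exponent [q] makes the q-th powers sum to [d]; [powR_young], summed
   over the coordinates, bounds the p-th powers by [d] as well. *)
pose c := d%:R `^ (- q^-1) * N.
have c0 : 0 < c by rewrite mulr_gt0 ?powR_gt0.
have -> : d%:R `^ (p^-1 - q^-1) * N = d%:R `^ p^-1 * c.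
  by rewrite /c mulrA -powRD // (gt_eqF D0) implybT.
rewrite powRM ?powR_ge0 ?(ltW c0) // -powRrM mulVf ?gt_eqF // powRr1 ?ler0n //.
have -> : \sum_(j < d) `|x j 0| `^ p = c `^ p * \sum_(j < d) (`|x j 0| / c) `^ p.
  rewrite mulr_sumr; apply: eq_bigr => j _.
  rewrite -powRM ?(ltW c0) ?divr_ge0 ?(ltW c0) //; congr (_ `^ _).
  by field; rewrite gt_eqF.
rewrite mulrC ler_wpM2r ?powR_ge0 //.
apply: (@le_trans _ _ (\sum_(j < d) (p / q * (`|x j 0| / c) `^ q + (1 - p / q)))).
  by apply: ler_sum => j _; apply: powR_young; rewrite ?divr_ge0 ?(ltW c0).
rewrite big_split /= -mulr_sumr sumr_const card_ord.
have -> : \sum_(j < d) (`|x j 0| / c) `^ q = d%:R.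
  under eq_bigr do rewrite powRM ?invr_ge0 ?(ltW c0) //.
  rewrite -mulr_suml -hN -powRM ?invr_ge0 ?(ltW c0) ?(ltW N0) //.
  have -> : N / c = d%:R `^ q^-1.
    rewrite /c powRN; field; rewrite gt_eqF ?powR_gt0 //=.
    by rewrite (gt_eqF N0).
  by rewrite -powRrM mulVf ?gt_eqF // powRr1 // ler0n.
by rewrite -[(1 - p / q) *+ d]mulr_natr mulrBl mul1r addrC subrK.
Qed.

Lemma pnorm_le_dhat p x : (0 < d)%N -> 1 <= p -> pnorm p x <= dhat d p * enorm x.
Proof.
move=> d0 p1; have p0 : 0 < p by exact: lt_le_trans p1.
rewrite /dhat /enorm; case: ifPn => [p2|]; first exact: pnorm_power_mean.
by rewrite -ltNge mul1r => /ltW p2; exact: pnorm_antitone.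
Qed.

Lemma enorm_le_dtilde p x : (0 < d)%N -> 1 <= p -> enorm x <= dtilde d p * pnorm p x.
Proof.
move=> d0 p1; have p0 : 0 < p by exact: lt_le_trans p1.
rewrite /dtilde /enorm; case: ifPn => [p2|]; first by rewrite mul1r; exact: pnorm_antitone.
by rewrite -ltNge => /ltW p2; exact: pnorm_power_mean.
Qed.

End PNorm.

(** * Euclidean inner product and deviation from the average *)

Section DotProduct.
Variables (R : realType) (d : nat).
Implicit Types u v w : 'cV[R]_d.

Definition dotp u v : R := \sum_(j < d) u j 0 * v j 0.

Lemma dotpp_ge0 u : 0 <= dotp u u.
Proof. by apply: sumr_ge0 => j _; rewrite -expr2 sqr_ge0. Qed.

Lemma enorm_ge0 u : 0 <= enorm u.
Proof. exact: powR_ge0. Qed.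

Lemma enorm_sqr u : enorm u ^+ 2 = dotp u u.
Proof.
rewrite -powR_mulrn ?enorm_ge0 // /enorm /pnorm -powRrM mulVf // powRr1.
  by apply: eq_bigr => j _; rewrite powR_mulrn // real_normK ?num_real // expr2.
by apply: sumr_ge0 => j _; exact: powR_ge0.
Qed.

Lemma dotpC u v : dotp u v = dotp v u.
Proof. by apply: eq_bigr => j _; rewrite mulrC. Qed.

Lemma dotpDl u v w : dotp (u + v) w = dotp u w + dotp v w.
Proof. by rewrite -big_split; apply: eq_bigr => j _; rewrite mxE mulrDl. Qed.

Lemma dotpZl (a : R) u v : dotp (a *: u) v = a * dotp u v.
Proof. by rewrite mulr_sumr; apply: eq_bigr => j _; rewrite mxE mulrA. Qed.

Lemma dotpNl u v : dotp (- u) v = - dotp u v.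
Proof. by rewrite -scaleN1r dotpZl mulN1r. Qed.

Lemma dotpDr u v w : dotp u (v + w) = dotp u v + dotp u w.
Proof. by rewrite !(dotpC u) dotpDl. Qed.

Lemma dotpZr (a : R) u v : dotp u (a *: v) = a * dotp u v.
Proof. by rewrite !(dotpC u) dotpZl. Qed.

Lemma dotpNr u v : dotp u (- v) = - dotp u v.
Proof. by rewrite !(dotpC u) dotpNl. Qed.

Lemma enorm_le_sqr u v (L : R) : 0 <= L ->
  enorm u <= L * enorm v -> dotp u u <= L ^+ 2 * dotp v v.
Proof.
move=> L0 h; rewrite -!enorm_sqr -exprMn.
by rewrite lerXn2r // nnegrE ?mulr_ge0 ?enorm_ge0.
Qed.

(* Cauchy-Schwarz, in the form that needs no square root. *)
Lemma dotp_le u v (L : R) : 0 < L ->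
  dotp u u <= L ^+ 2 * dotp v v -> dotp u v <= L * dotp v v.
Proof.
move=> L0 h.
have := dotpp_ge0 (u - L *: v).
rewrite !(dotpDl, dotpDr, dotpNl, dotpNr, dotpZl, dotpZr) (dotpC v u) => h2.
rewrite -(ler_pM2l L0); lra.
Qed.

Lemma avgE n (a : 'I_n -> 'cV[R]_d) j : avg a j 0 = n%:R^-1 * \sum_(i < n) a i j 0.
Proof. by rewrite mxE summxE. Qed.

Lemma sum_dotp_avg n (a : 'I_n -> 'cV[R]_d) : (0 < n)%N ->
  \sum_(i < n) dotp (a i) (a i)
  = \sum_(i < n) dotp (a i - avg a) (a i - avg a) + n%:R * dotp (avg a) (avg a).
Proof.
move=> n0; have nR : n%:R != 0 :> R by rewrite pnatr_eq0 -lt0n.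
have -> : \sum_(i < n) dotp (a i - avg a) (a i - avg a)
   = \sum_(i < n) dotp (a i) (a i) + \sum_(i < n) (- 2 * dotp (a i) (avg a))
     + \sum_(i < n) dotp (avg a) (avg a).
  rewrite -!big_split /=; apply: eq_bigr => i _.
  by rewrite !(dotpDl, dotpDr, dotpNl, dotpNr) (dotpC (avg a) (a i)); ring.
have sE : \sum_(i < n) dotp (a i) (avg a) = n%:R * dotp (avg a) (avg a).
  rewrite exchange_big mulr_sumr /=; apply: eq_bigr => j _.
  by rewrite -mulr_suml {2}avgE mulrA mulrA mulfV // mul1r.
by rewrite -mulr_sumr sE sumr_const card_ord; ring.
Qed.

End DotProduct.

(** * Gradients along lines and the descent lemma *)

Section Gradient.
Variables (R : realType) (d : nat).
Implicit Types (g : 'cV[R]_d -> R) (x y z : 'cV[R]_d).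

Lemma gradient_dotp g x z : differentiable g x -> 'D_z g x = dotp (gradient g x) z.
Proof.
move=> dg; rewrite deriveE // {1}(matrix_sum_delta z).
rewrite linear_sum; apply: eq_bigr => j _; rewrite big_ord1 linearZ /=.
by rewrite mxE -deriveE // mulrC.
Qed.

Lemma is_derive_line g x z (t : R) : differentiable g (x + t *: z) ->
  is_derive t 1 (fun s : R => g (x + s *: z)) (dotp (gradient g (x + t *: z)) z).
Proof.
move=> dg; have dz : derivable g (x + t *: z) z by exact: diff_derivable.
have E : (fun h : R => h^-1 *: (((fun s : R => g (x + s *: z)) \o shift t) (h *: 1)
          - g (x + t *: z)))
   = (fun h : R => h^-1 *: ((g \o shift (x + t *: z)) (h *: z) - g (x + t *: z))).
  apply: funext => h /=; congr (_ *: (g _ - _)).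
  by rewrite /shift /= -[h *: 1]/(h * 1) mulr1 scalerDl addrCA.
split; first by rewrite /derivable E.
by rewrite /derive E -gradient_dotp.
Qed.

(* Along the segment the quadratic upper model minus [g] has nonnegative
   derivative. *)
Lemma descent_lemma g (L : R) x y : 0 < L -> (forall z, differentiable g z) ->
  (forall u v, dotp (gradient g u - gradient g v) (gradient g u - gradient g v)
     <= L ^+ 2 * dotp (u - v) (u - v)) ->
  g y <= g x + dotp (gradient g x) (y - x) + L / 2 * dotp (y - x) (y - x).
Proof.
move=> L0 dg lip; pose z := y - x.
pose q (t : R) := t * dotp (gradient g x) z + t ^+ 2 * (L / 2 * dotp z z).
pose psi (t : R) := g (x + t *: z) - q t.
have dpsi (t : R) : is_derive t 1 psi
   (dotp (gradient g (x + t *: z)) z - (dotp (gradient g x) z + t * (L * dotp z z))).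
  have d1 := is_derive_line (dg (x + t *: z)).
  have d2 : is_derive t 1 q (dotp (gradient g x) z + t * (L * dotp z z)).
    rewrite /q; apply: is_derive_eq.
    rewrite /GRing.scale /=; field => //.
  by have := is_deriveB d1 d2.
have cpsi : {within `[0, 1], continuous psi}%classic.
  apply: continuous_subspaceT => t.
  by apply: differentiable_continuous; apply/derivable1_diffP; case: (dpsi t).
have [c /[!in_itv]/= /andP[c0 c1] hc] := @MVT R psi _ 0 1 ltr01 (fun t _ => dpsi t) cpsi.
have : psi 1 <= psi 0.
  rewrite -subr_le0 hc subr0 mulr1.
  have := lip (x + c *: z) x; rewrite addrAC subrr add0r => hl.
  (* For the displacement [c *: z] the Lipschitz constant relative to [z] is [c * L], positive
     because the mean value point is interior. [dotp_le] then gives exactly the term subtracted in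
     the derivative of [psi]. *)
  have : dotp (gradient g (x + c *: z) - gradient g x) z <= c * L * dotp z z.
    apply: dotp_le; first exact: mulr_gt0.
    by apply: (le_trans hl); rewrite dotpZl dotpZr exprMn; lra.
  rewrite dotpDl dotpNl; lra.
have xz : x + z = y by rewrite /z addrC subrK.
rewrite /psi /q scale1r scale0r addr0 xz expr1n expr0n /= -/z; lra.
Qed.

End Gradient.

(** * The averaged objective *)

Section AverageFunction.
Variables (R : realType) (n d : nat) (f : 'I_n -> 'cV[R]_d -> R).
Hypotheses (n_gt0 : (0 < n)%N) (df : forall i x, differentiable (f i) x).

Let avg_funE : avg_fun f = n%:R^-1 \*: (\sum_(i < n) f i).
Proof.
apply: funext => x; rewrite /avg_fun /= fct_sumE.
by rewrite /GRing.scale /=.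
Qed.

Lemma differentiable_avg_fun x : differentiable (avg_fun f) x.
Proof.
by rewrite avg_funE; apply: differentiableZ; apply: differentiable_sum.
Qed.

Lemma gradient_avg_fun x : gradient (avg_fun f) x = avg (fun i => gradient (f i) x).
Proof.
apply/colP => j; rewrite avgE mxE avg_funE.
have di i : derivable (f i) x (delta_mx j 0) by exact: diff_derivable.
rewrite deriveZ; last by apply: derivable_sum.
rewrite derive_sum // /GRing.scale /=; congr (_ * _).
by apply: eq_bigr => i _; rewrite mxE.
Qed.

(** Jensen for the square: [sum_dotp_avg] bounds [n] times the square of an average by the sum of
    the squares. *)
Lemma lipschitz_gradient_avg_fun (L : R) :
  (forall i u v, dotp (gradient (f i) u - gradient (f i) v) (gradient (f i) u - gradient (f i) v)
     <= L ^+ 2 * dotp (u - v) (u - v)) ->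
  forall u v, dotp (gradient (avg_fun f) u - gradient (avg_fun f) v)
     (gradient (avg_fun f) u - gradient (avg_fun f) v) <= L ^+ 2 * dotp (u - v) (u - v).
Proof.
move=> h u v; have nR : 0 < n%:R :> R by rewrite ltr0n.
rewrite !gradient_avg_fun.
have -> : avg (fun i => gradient (f i) u) - avg (fun i => gradient (f i) v)
   = avg (fun i => gradient (f i) u - gradient (f i) v).
  by rewrite /avg -scalerBr -sumrB.
have := sum_dotp_avg (fun i => gradient (f i) u - gradient (f i) v) n_gt0.
set a := avg _ => e.
rewrite -(ler_pM2l nR); apply: (@le_trans _ _
  (\sum_(i < n) dotp (gradient (f i) u - gradient (f i) v) (gradient (f i) u - gradient (f i) v))).
  by rewrite e lerDr; apply: sumr_ge0 => i _; exact: dotpp_ge0.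
apply: (@le_trans _ _ (\sum_(i < n) L ^+ 2 * dotp (u - v) (u - v))).
  by apply: ler_sum => i _; exact: h.
by rewrite sumr_const card_ord -[X in X <= _]mulr_natl.
Qed.

End AverageFunction.

(** If [v *m Q] vanished, so would [z *: v]; hence an eigenvector of a nonzero eigenvalue survives
    in coordinates. It is stated over any field, with [Qt] free, to serve both for [R] and for the
    complexification inside [spectral_radius]. *)
Lemma eigenvalue_diag (F : fieldType) (n m : nat) (Q : 'M[F]_(n, m)) (Qt : 'M[F]_(m, n))
    (D : 'rV[F]_m) (z : F) : Qt *m Q = 1%:M ->
  eigenvalue (Q *m diag_mx D *m Qt) z -> z != 0 -> exists l, z = D 0 l.
Proof.
move=> QQ /eigenvalueP[v vM v0] z0; pose u := v *m Q.
have uD : u *m diag_mx D = z *: u.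
  by rewrite /u scalemxAl -vM -!mulmxA QQ mulmx1.
have /rV0Pn[l ul] : u != 0.
  apply: contraNneq v0 => u0; have := vM; rewrite !mulmxA -/u u0 !mul0mx.
  by move/esym/eqP; rewrite scaler_eq0 (negPf z0).
exists l; move/rowP/(_ l): uD; rewrite mul_mx_diag [LHS]mxE [RHS]mxE => h.
by apply: (mulIf ul); rewrite -h mulrC.
Qed.

(** * Eigenvalues of the Laplacian *)

Section Spectrum.
Variables (R : realType) (n : nat) (A : 'M[R]_n) (lam : nat -> R) (Q : 'M[R]_(n, n.-1)).
Hypotheses (hn : (2 <= n)%N) (hA : weighted_graph A)
  (hspec : spectral_decomposition (laplacian A) lam Q).

Lemma ones_normalized_dot :
  ((Num.sqrt n%:R)^-1 *: ones R n) *m ((Num.sqrt n%:R)^-1 *: ones R n)^T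
  = n%:R^-1 *: (ones R n *m (ones R n)^T).
Proof.
rewrite linearZ /= -scalemxAl -scalemxAr scalerA -invfM -expr2 sqr_sqrtr ?ler0n //.
Qed.

Lemma Q_orthonormal : Q^T *m Q = 1%:M.
Proof.
have := basis_orthonormal hspec.
by rewrite tr_row_mx mul_col_row scalar_mx_block => /eq_block_mx[].
Qed.

Lemma Q_complete : Q *m Q^T = Kmx R n.
Proof.
have := basis_complete hspec.
by rewrite tr_row_mx mul_row_col ones_normalized_dot /Kmx => <-; rewrite addrAC subrr add0r.
Qed.

Lemma Q_ones : Q^T *m ones R n = 0.
Proof.
have := basis_orthonormal hspec.
rewrite tr_row_mx mul_col_row scalar_mx_block => /eq_block_mx[_ _ + _].
rewrite -scalemxAr => /eqP; rewrite scaler_eq0 invr_eq0 sqrtr_eq0 => /orP[|/eqP//].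
by rewrite leNgt ltr0n (ltn_trans _ hn).
Qed.

Lemma laplacian_Q : laplacian A *m Q = Q *m diag_mx (lam_row n lam).
Proof. by rewrite {1}(laplacian_diag hspec) -!mulmxA Q_orthonormal mulmx1. Qed.

Lemma Q_laplacian : Q^T *m laplacian A = diag_mx (lam_row n lam) *m Q^T.
Proof. by rewrite {1}(laplacian_diag hspec) !mulmxA Q_orthonormal mul1mx. Qed.

Lemma laplacian_ones : laplacian A *m ones R n = 0.
Proof. by rewrite (laplacian_diag hspec) -mulmxA Q_ones mulmx0. Qed.

Lemma laplacianE i j : laplacian A i j = (\sum_k A i k) *+ (i == j) - A i j.
Proof. by rewrite !mxE. Qed.

(** By symmetry of the weights the form is half the sum of [A i j * (u i - u j) ^+ 2]. *)
Lemma laplacian_psd (u : 'I_n -> R) :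
  0 <= \sum_i \sum_j u i * laplacian A i j * u j.
Proof.
case: hA => As A0 _.
have Asym i j : A i j = A j i by rewrite -{1}As mxE.
have diagE : \sum_i \sum_j u i * ((\sum_k A i k) *+ (i == j)) * u j
   = \sum_i \sum_k A i k * u i ^+ 2.
  apply: eq_bigr => i _; rewrite (bigD1 i) //= eqxx [X in _ + X = _]big1 ?addr0.
    by rewrite -mulr_suml mulr1n; ring.
  by move=> j ji; rewrite eq_sym (negPf ji) mulr0n mulr0 mul0r.
have -> : \sum_i \sum_j u i * laplacian A i j * u j
   = 2^-1 * \sum_i \sum_j A i j * (u i - u j) ^+ 2.
  apply: (mulfI (_ : 2 != 0 :> R)) => //; rewrite mulrA mulfV // mul1r.
  transitivity (\sum_i \sum_k A i k * u i ^+ 2 + \sum_i \sum_k A i k * u k ^+ 2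
      + \sum_i \sum_k (- 2 * (A i k * (u i * u k)))); last first.
    rewrite -!big_split; apply: eq_bigr => i _ /=.
    by rewrite -!big_split; apply: eq_bigr => j _ /=; ring.
  have -> : \sum_i \sum_k A i k * u k ^+ 2 = \sum_i \sum_k A i k * u i ^+ 2.
    rewrite exchange_big; apply: eq_bigr => i _; apply: eq_bigr => j _.
    by rewrite Asym.
  rewrite -mulr2n -[X in X + _]mulr_natl -diagE !mulr_sumr -big_split; apply: eq_bigr => i _ /=.
  rewrite !mulr_sumr -big_split; apply: eq_bigr => j _ /=.
  by rewrite laplacianE; ring.
by rewrite mulr_ge0 ?invr_ge0 // !sumr_ge0 // => i _; apply: sumr_ge0 => j _;
  rewrite mulr_ge0 ?sqr_ge0.
Qed.

(** The decomposition only excludes zero; the sign comes from the quadratic form at column [l] of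
    [Q], whose value is the eigenvalue. *)
Let lam_gt0 (l : 'I_n.-1) : 0 < lam l.+2.
Proof.
have ln : (l.+2 <= n)%N by have := ltn_ord l; rewrite ltn_predRL.
rewrite lt_neqAle eq_sym (lam_neq0 hspec) ?ln //=.
have := laplacian_psd (fun i => Q i l).
suff -> : \sum_i \sum_j Q i l * laplacian A i j * Q j l = lam l.+2 by [].
have : (Q^T *m (laplacian A *m Q)) l l = lam l.+2.
  by rewrite laplacian_Q mulmxA Q_orthonormal mul1mx !mxE eqxx mulr1n.
rewrite mxE => <-; apply: eq_bigr => i _; rewrite !mxE mulr_sumr.
by apply: eq_bigr => j _; rewrite mulrA.
Qed.

Lemma eigenvalue_lam (l : 'I_n.-1) : eigenvalue (laplacian A) (lam l.+2).
Proof.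
apply/eigenvalueP; exists (row l Q^T).
  by rewrite -row_mul Q_laplacian mul_diag_mx; apply/rowP => i; rewrite !mxE.
apply/eqP => h; have : (row l Q^T) *m Q = row l 1%:M by rewrite -row_mul Q_orthonormal.
rewrite h mul0mx => /rowP/(_ l); rewrite !mxE eqxx => /esym/eqP.
by rewrite oner_eq0.
Qed.

Lemma lam_ge_rho2 l : min_pos_eigenvalue (laplacian A) <= lam (l : 'I_n.-1).+2.
Proof.
apply: ge_inf; first by exists 0 => a [_ /ltW].
by split; [exact: eigenvalue_lam|exact: lam_gt0].
Qed.

(** An infimum of positive numbers could be 0. By [eigenvalue_diag] every positive eigenvalue is
    some [lam l.+2], and the ordering puts [lam 2] below all of them. *)
Lemma rho2_gt0 : 0 < min_pos_eigenvalue (laplacian A).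
Proof.
have n1 : (0 < n.-1)%N by case: (n) hn => [|[]].
pose l0 := Ordinal n1.
apply: (@lt_le_trans _ _ (lam 2)); first exact: (lam_gt0 l0).
apply: lb_le_inf.
  by exists (lam 2); split; [exact: (eigenvalue_lam l0)|exact: (lam_gt0 l0)].
move=> a [+ a0]; rewrite {1}(laplacian_diag hspec).
move=> /(eigenvalue_diag Q_orthonormal)/(_ (lt0r_neq0 a0))[l ->]; rewrite mxE.
have : (l.+2 <= n)%N by have := ltn_ord l; rewrite ltn_predRL.
elim: (nat_of_ord l) => // k IH kn; apply: (le_trans (IH (ltnW kn))).
exact: (lam_sorted hspec).
Qed.

Lemma lam_le_rho l : lam (l : 'I_n.-1).+2 <= spectral_radius (laplacian A).
Proof.
have normE (a : R) : ComplexField.Normc.normc (real_complex R a) = `|a|.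
  by rewrite /= expr0n /= addr0 sqrtr_sqr.
have QQ : map_mx (real_complex R) Q^T *m map_mx (real_complex R) Q = 1%:M.
  by rewrite -map_mxM Q_orthonormal map_mx1.
apply: ub_le_sup.
  (* [sup] dominates only a set that is bounded above. The set ranges over complex eigenvalues, each
     of which is 0 or some [lam]. *)
  exists (\sum_(i < n.-1) `|lam i.+2|) => _ [z /= ez <-].
  have [->|z0] := eqVneq z 0.
    by rewrite ComplexField.Normc.normc0 sumr_ge0.
  move: ez; rewrite (laplacian_diag hspec) !map_mxM map_diag_mx.
  move=> /(eigenvalue_diag QQ)/(_ z0)[i ->]; rewrite !mxE normE.
  by rewrite (bigD1 i) //= lerDl sumr_ge0.
exists (real_complex R (lam l.+2)); last by rewrite normE gtr0_norm.
have /eigenvalueP[v vL v0] := eigenvalue_lam l.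
apply/eigenvalueP; exists (map_mx (real_complex R) v).
  by rewrite -map_mxM vL map_mxZ.
by rewrite map_mx_eq0.
Qed.

End Spectrum.

(** * Stacked vectors and Kronecker products *)

Section Stacking.
Variables (R : realType) (n d : nat).
Implicit Types (u w : 'I_n -> 'cV[R]_d) (M N : 'M[R]_n).

Lemma kron_stack M u :
  kron M (1%:M : 'M[R]_d) *m stack u = stack (fun i => \sum_j M i j *: u j).
Proof.
rewrite /kron /stack mul_mxblock_mxrow; apply: eq_mxcol => i.
by apply: eq_bigr => j _; rewrite -scalemxAl mul1mx.
Qed.

Lemma stack_dot u w : (stack u)^T *m stack w = (\sum_i dotp (u i) (w i))%:M.
Proof.
rewrite /stack tr_mxcol mul_mxrow_mxcol; apply/matrixP => a b.
rewrite !ord1 summxE !mxE mulr1n; apply: eq_bigr => i _.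
by rewrite mxE; apply: eq_bigr => j _; rewrite mxE.
Qed.

Lemma kron_mul_stack M N u :
  kron M (1%:M : 'M[R]_d) *m kron N (1%:M : 'M[R]_d) *m stack u
  = kron (M *m N) (1%:M : 'M[R]_d) *m stack u.
Proof.
rewrite -mulmxA !kron_stack; apply: eq_mxcol => i.
under eq_bigr do rewrite scaler_sumr.
rewrite exchange_big; apply: eq_bigr => j _ /=.
by rewrite mxE scaler_suml; apply: eq_bigr => k _; rewrite scalerA.
Qed.

Lemma stack_kron_form M u w :
  ((stack u)^T *m kron M (1%:M : 'M[R]_d) *m stack w) 0 0
  = \sum_i \sum_j M i j * dotp (u i) (w j).
Proof.
rewrite -mulmxA kron_stack stack_dot mxE mulr1n; apply: eq_bigr => i _.
have dotp_sumr : forall r : seq 'I_n,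
    dotp (u i) (\sum_(j <- r) M i j *: w j) = \sum_(j <- r) M i j * dotp (u i) (w j).
  elim=> [|j r IH]; first by rewrite !big_nil /dotp big1 // => k _; rewrite mxE mulr0.
  by rewrite !big_cons dotpDr dotpZr IH.
exact: dotp_sumr.
Qed.

Lemma enorm_stack_sqr u : enorm (stack u) ^+ 2 = \sum_i dotp (u i) (u i).
Proof.
rewrite enorm_sqr; have /matrixP/(_ 0 0) := stack_dot u u.
rewrite [LHS]mxE [RHS]mxE eqxx mulr1n => <-; apply: eq_bigr => j _.
by rewrite [in RHS]mxE.
Qed.

End Stacking.

(** * Coordinates in the eigenbasis *)

Section Coordinates.
Variables (R : realType) (n d : nat) (A : 'M[R]_n) (lam : nat -> R) (Q : 'M[R]_(n, n.-1)).
Hypotheses (hn : (2 <= n)%N) (hA : weighted_graph A)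
  (hspec : spectral_decomposition (laplacian A) lam Q).
Implicit Types (u w : 'I_n -> 'cV[R]_d).

(** Block [l] of the stacked vector after applying [Q^T] tensored with the identity. Only the
    nonconstant directions occur; [avg] carries the remaining one. *)
Definition coord u (l : 'I_n.-1) : 'cV[R]_d := \sum_i Q i l *: u i.

Lemma coordE u l j : coord u l j 0 = \sum_i Q i l * u i j 0.
Proof. by rewrite summxE; apply: eq_bigr => i _; rewrite mxE. Qed.

Lemma coordD u w l : coord (fun i => u i + w i) l = coord u l + coord w l.
Proof. by rewrite -big_split; apply: eq_bigr => i _; rewrite scalerDr. Qed.

Lemma coordZ (a : R) u l : coord (fun i => a *: u i) l = a *: coord u l.
Proof. by rewrite scaler_sumr; apply: eq_bigr => i _; rewrite !scalerA mulrC. Qed.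

Lemma coordB u w l : coord (fun i => u i - w i) l = coord u l - coord w l.
Proof. by rewrite -sumrB; apply: eq_bigr => i _; rewrite scalerBr. Qed.

Lemma coord_laplacian u l :
  coord (fun i => \sum_j laplacian A i j *: u j) l = lam l.+2 *: coord u l.
Proof.
rewrite /coord; under eq_bigr do rewrite scaler_sumr.
rewrite exchange_big scaler_sumr; apply: eq_bigr => j _ /=.
under eq_bigr do rewrite scalerA.
rewrite -scaler_suml scalerA; congr (_ *: _).
have /matrixP/(_ l j) := Q_laplacian hspec.
rewrite mul_diag_mx [LHS]mxE [RHS]mxE !mxE => <-; apply: eq_bigr => i _.
by rewrite [Q^T _ _]mxE.
Qed.

Lemma laplacian_sum_col j : \sum_i laplacian A i j = 0.
Proof.
case: hA => As _ _; have /colP/(_ j) := laplacian_ones hn hspec; rewrite !mxE.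
apply: etrans; apply: eq_bigr => i _.
have Asym a b : A a b = A b a by rewrite -{1}As mxE.
rewrite !laplacianE !mxE mulr1 (Asym i j) (eq_sym i j).
by case: eqP => // ->.
Qed.

Lemma sum_laplacian u : \sum_i \sum_j laplacian A i j *: u j = 0.
Proof.
rewrite exchange_big big1 // => j _ /=.
by rewrite -scaler_suml laplacian_sum_col scale0r.
Qed.

(** Passage between sums over modes and matrix forms: [D = 1] gives [Kmx], the reciprocals of [lam]
    give [Pmx] off the constants. *)
Lemma sum_coord (D : 'rV[R]_n.-1) u w :
  \sum_l D 0 l * dotp (coord u l) (coord w l)
  = \sum_i \sum_j (Q *m diag_mx D *m Q^T) i j * dotp (u i) (w j).
Proof.
have dotp_coord l : dotp (coord u l) (coord w l)
    = \sum_i \sum_j Q i l * Q j l * dotp (u i) (w j).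
  rewrite /dotp; under eq_bigr do rewrite !coordE mulr_suml.
  rewrite exchange_big; apply: eq_bigr => i _ /=.
  under eq_bigr do rewrite mulr_sumr.
  rewrite exchange_big; apply: eq_bigr => j _ /=.
  by rewrite mulr_sumr; apply: eq_bigr => k _; ring.
under eq_bigr do rewrite dotp_coord mulr_sumr.
rewrite exchange_big; apply: eq_bigr => i _ /=.
under eq_bigr do rewrite mulr_sumr.
rewrite exchange_big; apply: eq_bigr => j _ /=.
rewrite mxE mulr_suml; apply: eq_bigr => l _.
by rewrite mul_mx_diag !mxE; ring.
Qed.

Lemma sum_dotp_mean u w :
  \sum_i \sum_j n%:R^-1 * dotp (u i) (w j) = n%:R * dotp (avg u) (avg w).
Proof.
have nR : n%:R != 0 :> R by rewrite pnatr_eq0 -lt0n (ltn_trans _ hn).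
rewrite [in RHS]/dotp mulr_sumr.
transitivity (\sum_i \sum_j \sum_k n%:R^-1 * (u i k 0 * w j k 0)).
  by apply: eq_bigr => i _; apply: eq_bigr => j _; rewrite mulr_sumr.
under eq_bigr do rewrite exchange_big /=.
rewrite exchange_big; apply: eq_bigr => k _ /=.
rewrite !avgE; set s := \sum_i u i k 0.
transitivity (n%:R^-1 * (s * \sum_j w j k 0)); last by field.
rewrite /s mulr_suml mulr_sumr; apply: eq_bigr => i _.
by rewrite !mulr_sumr.
Qed.

Lemma KmxE i j : Kmx R n i j = (i == j)%:R - n%:R^-1.
Proof.
have onesE : (ones R n *m (ones R n)^T) i j = 1 by rewrite mxE big_ord1 !mxE mul1r.
by rewrite mxE [1%:M _ _]mxE [X in _ + X]mxE [X in - X]mxE onesE mulr1.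
Qed.

Lemma parseval u :
  \sum_l dotp (coord u l) (coord u l) = \sum_i dotp (u i - avg u) (u i - avg u).
Proof.
have n0 : (0 < n)%N by exact: ltn_trans hn.
have := sum_coord (const_mx 1) u u.
under eq_bigr do rewrite mxE mul1r.
rewrite diag_const_mx mulmx1 (Q_complete hspec) => ->.
apply: (addIr (n%:R * dotp (avg u) (avg u))); rewrite -(sum_dotp_avg u n0).
rewrite -sum_dotp_mean -big_split; apply: eq_bigr => i _ /=.
rewrite -big_split (bigD1 i) //= big1 ?addr0 => [|j ji]; rewrite -mulrDl KmxE subrK.
  by rewrite eqxx mul1r.
by rewrite eq_sym (negPf ji) mul0r.
Qed.

Lemma parseval_le u : \sum_l dotp (coord u l) (coord u l) <= \sum_i dotp (u i) (u i).
Proof.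
have n0 : (0 < n)%N by exact: ltn_trans hn.
by rewrite parseval (sum_dotp_avg u n0) lerDl mulr_ge0 ?dotpp_ge0.
Qed.

Lemma Pmx_form u w :
  \sum_i \sum_j Pmx lam Q i j * dotp (u i) (w j)
  = \sum_(l < n.-1) (lam l.+2)^-1 * dotp (coord u l) (coord w l)
    + n%:R / lam n * dotp (avg u) (avg w).
Proof.
have -> : \sum_(l < n.-1) (lam l.+2)^-1 * dotp (coord u l) (coord w l) =
    \sum_(l < n.-1) (lam_row n (fun i => (lam i)^-1)) 0 l * dotp (coord u l) (coord w l).
  by apply: eq_bigr => l _; rewrite mxE.
rewrite sum_coord (_ : n%:R / lam n * dotp (avg u) (avg w)
    = (lam n)^-1 * (n%:R * dotp (avg u) (avg w))); last by ring.
rewrite -sum_dotp_mean mulr_sumr -big_split; apply: eq_bigr => i _ /=.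
rewrite mulr_sumr -big_split; apply: eq_bigr => j _ /=.
have onesE a b : (ones R n *m (ones R n)^T) a b = 1.
  by rewrite mxE big_ord1 !mxE mul1r.
have -> : Pmx lam Q i j = (lam n)^-1 * n%:R^-1
    + (Q *m diag_mx (lam_row n (fun k => (lam k)^-1)) *m Q^T) i j.
  rewrite /Pmx [LHS]mxE; congr (_ + _).
  by rewrite [LHS]mxE [X in _ * X]mxE onesE mulr1.
by ring.
Qed.

Lemma Kmx_form u : \sum_i \sum_j Kmx R n i j * dotp (u i) (u j)
  = \sum_l dotp (coord u l) (coord u l).
Proof.
have := sum_coord (const_mx 1) u u.
under eq_bigr do rewrite mxE mul1r.
by rewrite diag_const_mx mulmx1 (Q_complete hspec).
Qed.

Lemma Kmx_mul_Pmx : Kmx R n *m Pmx lam Q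
  = Q *m diag_mx (lam_row n (fun i => (lam i)^-1)) *m Q^T.
Proof.
rewrite -(Q_complete hspec) /Pmx mulmxDr -!scalemxAr.
have -> : Q *m Q^T *m (ones R n *m (ones R n)^T) = 0.
  by rewrite -(mulmxA Q) (mulmxA Q^T) (Q_ones hn hspec) mul0mx mulmx0.
rewrite !scaler0 add0r !mulmxA -(mulmxA Q Q^T Q).
by rewrite (Q_orthonormal hspec) mulmx1.
Qed.

(** So [kappa8] is the initial Lyapunov value with [n] times the gap replaced by its
    Polyak-Lojasiewicz bound; the condition on [s0] thereby starts the induction. *)
Lemma kappa8E (al be nu : R) u w (v0 g0 : 'cV[R]_(\sum_(i < n) d)) (g : 'cV[R]_d) :
  be != 0 -> v0 + be^-1 *: g0 = stack w ->
  kappa8 al be nu (kron (Kmx R n) (1%:M : 'M[R]_d)) (kron (Pmx lam Q) (1%:M : 'M[R]_d))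
    (stack u) v0 g0 (stack (fun _ : 'I_n => g))
  = \sum_(l < n.-1) \sum_(j < d)
      mode_energy (al / be) (lam l.+2) (coord u l j 0) (coord w l j 0)
    + (1 + al / be) / 2 * (n%:R / lam n * dotp (avg w) (avg w))
    + (2 * nu)^-1 * (n%:R * dotp g g).
Proof.
move=> be0 e; rewrite /kappa8 e /wsqnorm enorm_stack_sqr.
have -> : ((stack w)^T *m (((al + be) / be) *: kron (Pmx lam Q) (1%:M : 'M[R]_d))
    *m stack w) 0 0
  = (1 + al / be) * (\sum_(l < n.-1) (lam l.+2)^-1 * dotp (coord w l) (coord w l)
    + n%:R / lam n * dotp (avg w) (avg w)).
  rewrite -scalemxAr -scalemxAl mxE stack_kron_form Pmx_form.
  by rewrite mulrDl mulfV // addrC.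
have -> : ((stack u)^T *m kron (Kmx R n) (1%:M : 'M[R]_d)
    *m kron (Pmx lam Q) (1%:M : 'M[R]_d) *m stack w) 0 0
  = \sum_(l < n.-1) (lam l.+2)^-1 * dotp (coord u l) (coord w l).
  rewrite -mulmxA -mulmxA (mulmxA (kron _ _)) kron_mul_stack mulmxA stack_kron_form.
  by rewrite Kmx_mul_Pmx -sum_coord; apply: eq_bigr => l _; rewrite mxE.
rewrite stack_kron_form Kmx_form sumr_const card_ord -[_ *+ n]mulr_natl.
have -> : \sum_(l < n.-1) \sum_(j < d)
      mode_energy (al / be) (lam l.+2) (coord u l j 0) (coord w l j 0)
  = 2^-1 * \sum_l dotp (coord u l) (coord u l)
    + (1 + al / be) / 2 * \sum_(l < n.-1) (lam l.+2)^-1 * dotp (coord w l) (coord w l)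
    + \sum_(l < n.-1) (lam l.+2)^-1 * dotp (coord u l) (coord w l).
  rewrite !mulr_sumr -!big_split; apply: eq_bigr => l _ /=.
  rewrite /dotp !mulr_sumr -!big_split; apply: eq_bigr => j _ /=.
  by rewrite /mode_energy; ring.
by ring.
Qed.

End Coordinates.

Section DoubleSum.
Variables (R : comPzRingType) (m d : nat).
Implicit Types F G : 'I_m -> 'I_d -> R.

Lemma sum2D F G : \sum_l \sum_j (F l j + G l j)
  = \sum_l \sum_j F l j + \sum_l \sum_j G l j.
Proof. by rewrite -big_split; apply: eq_bigr => l _; rewrite big_split. Qed.

Lemma sum2Z (c : R) F : \sum_l \sum_j (c * F l j) = c * \sum_l \sum_j F l j.
Proof. by rewrite mulr_sumr; apply: eq_bigr => l _; rewrite mulr_sumr. Qed.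

End DoubleSum.

(** * Energies summed over all modes and components *)

Section Families.
Variables (R : realType) (n d : nat) (A : 'M[R]_n) (lam : nat -> R) (Q : 'M[R]_(n, n.-1)).
Variables (al be rho rho2 : R).
Hypotheses (hn : (2 <= n)%N) (hA : weighted_graph A)
  (hspec : spectral_decomposition (laplacian A) lam Q).
Hypotheses (rho2_gt0 : 0 < rho2) (rho2_lam : forall l : 'I_n.-1, rho2 <= lam l.+2)
  (lam_rho : forall l : 'I_n.-1, lam l.+2 <= rho).
Hypotheses (be_gt0 : 0 < be) (be_al : be <= al) (be_alrho2 : be < al * rho2).
Implicit Types (u X W E H T : 'I_n -> 'cV[R]_d).

Definition modes_energy X W : R := \sum_(l < n.-1) \sum_(j < d)
  mode_energy (al / be) (lam l.+2) (coord Q X l j 0) (coord Q W l j 0).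

Definition modes_sqr u : R := \sum_(l < n.-1) \sum_(j < d) coord Q u l j 0 ^+ 2.

Definition modes_sqr_div u : R :=
  \sum_(l < n.-1) \sum_(j < d) coord Q u l j 0 ^+ 2 / lam l.+2.

(** The squared coordinate along the unit vector [ones / sqrt n]; it completes [modes_sqr] to the
    full squared norm. *)
Definition mean_sqr u : R := n%:R * dotp (avg u) (avg u).

Definition lapl u (i : 'I_n) : 'cV[R]_d := \sum_j laplacian A i j *: u j.

(* Minus the increment of [x] divided by [eta]; the summands [be *: W] and [H] split
   [beta v + grad f_i (x_i)] so that [H] vanishes at consensus. *)
Definition direction X E W H (i : 'I_n) : 'cV[R]_d :=
  al *: lapl (fun j => X j - E j) i + be *: W i + H i.

Let al_gt0 : 0 < al. Proof. exact: lt_le_trans be_al. Qed.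

Let lam_gt0 (l : 'I_n.-1) : 0 < lam l.+2.
Proof. exact: lt_le_trans (rho2_lam l). Qed.

Let be_allam (l : 'I_n.-1) : be <= al * lam l.+2.
Proof. by rewrite (le_trans (ltW be_alrho2)) // ler_pM2l. Qed.

Lemma modes_sqr_ge0 u : 0 <= modes_sqr u.
Proof. by do 2![apply: sumr_ge0 => ? _]; exact: sqr_ge0. Qed.

Lemma modes_sqr_div_ge0 u : 0 <= modes_sqr_div u.
Proof.
by apply: sumr_ge0 => l _; apply: sumr_ge0 => j _; rewrite divr_ge0 ?sqr_ge0 // ltW.
Qed.

Lemma mean_sqr_ge0 u : 0 <= mean_sqr u.
Proof. by rewrite mulr_ge0 ?dotpp_ge0. Qed.

Lemma modes_sqrE u : modes_sqr u = \sum_l dotp (coord Q u l) (coord Q u l).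
Proof. by apply: eq_bigr => l _; apply: eq_bigr => j _; rewrite expr2. Qed.

Lemma modes_sqr_dev u : modes_sqr u = \sum_i dotp (u i - avg u) (u i - avg u).
Proof. by rewrite modes_sqrE (parseval hn hspec). Qed.

Lemma modes_sqr_mean u : modes_sqr u + mean_sqr u = \sum_i dotp (u i) (u i).
Proof.
have n0 : (0 < n)%N by exact: ltn_trans hn.
by rewrite modes_sqr_dev (sum_dotp_avg u n0).
Qed.

Lemma coord_direction X E W H l j :
  coord Q (direction X E W H) l j 0
  = al * lam l.+2 * (coord Q X l j 0 - coord Q E l j 0) + be * coord Q W l j 0
    + coord Q H l j 0.
Proof.
rewrite /direction !coordD !coordZ /lapl (coord_laplacian hspec) coordB.
by rewrite !mxE; ring.
Qed.

Lemma modes_descent (eta : R) X W E H T : 0 <= eta ->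
  modes_energy (fun i => X i - eta *: direction X E W H i)
    (fun i => W i + eta *: (be *: lapl (fun j => X j - E j) i + be^-1 *: T i))
  <= modes_energy X W
   + eta * ((- (al * rho2) / 2 + 5 / 4 * be + 1) * modes_sqr X
     + (al * rho / 2 + be * rho + be) * modes_sqr E
     + (- be / 2 + rho2^-1) * modes_sqr_div W + 3 / 4 * modes_sqr H
     + ((2 * be ^+ 2 * rho2 ^+ 2)^-1 + (al + be) ^+ 2 / (be ^+ 5 * rho2)) * modes_sqr T)
   + eta ^+ 2 * ((9 / 4 * al ^+ 2 * rho ^+ 2 + 3 / 2 * be ^+ 2 + 1)
       * (modes_sqr X + modes_sqr E)
     + (2 * be ^+ 2 * rho + rho2^-1) * modes_sqr_div W + 15 / 4 * modes_sqr H
     + (3 / 4 + (2 * be ^+ 2 * rho2 ^+ 2)^-1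
        + (al + be) / (2 * be ^+ 3 * rho2)) * modes_sqr T).
Proof.
move=> eta0.
rewrite /modes_energy /modes_sqr /modes_sqr_div -!(sum2D, sum2Z).
apply: ler_sum => l _; apply: ler_sum => j _.
have := mode_descent rho2_gt0 (rho2_lam l) (lam_rho l) be_gt0 be_al (be_allam l)
  (coord Q X l j 0) (coord Q E l j 0) (coord Q W l j 0) (coord Q H l j 0)
  (coord Q T l j 0) eta0.
apply: le_trans; rewrite le_eqVlt; apply/orP; left; apply/eqP.
rewrite coordB coordZ [X in mode_energy _ _ X _]mxE [X in _ + X]mxE [X in - X]mxE.
rewrite coord_direction coordD coordZ coordD !coordZ (coord_laplacian hspec) coordB.
rewrite !mxE; congr (mode_energy _ _ _ _); ring.
Qed.

(** The part of the [Pmx] form on constant vectors. There is no [x] term, since [Kmx] annihilates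
    constants. *)
Definition mean_energy W : R := (1 + al / be) / 2 * (mean_sqr W / lam n).

Lemma lam_n_bounds : rho2 <= lam n <= rho.
Proof.
(* The last ordinal of ['I_n.-1] is [n - 2], and it belongs to [lam n]. *)
have n2 : (n.-2 < n.-1)%N by rewrite prednK // ltn_predRL.
have := rho2_lam (Ordinal n2); have := lam_rho (Ordinal n2) => /=.
by rewrite prednK ?ltn_predRL // prednK ?(ltn_trans _ hn) // => -> ->.
Qed.

Lemma avgD u W : avg (fun i => u i + W i) = avg u + avg W.
Proof. by rewrite /avg big_split scalerDr. Qed.

Lemma avgZ (a : R) u : avg (fun i => a *: u i) = a *: avg u.
Proof. by rewrite /avg -scaler_sumr !scalerA mulrC. Qed.

Lemma avg_lapl u : avg (lapl u) = 0.
Proof. by rewrite /avg (sum_laplacian hn hA hspec) scaler0. Qed.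

Lemma avg_direction X E W H : avg (direction X E W H) = be *: avg W + avg H.
Proof. by rewrite /direction !avgD !avgZ avg_lapl scaler0 add0r. Qed.

Lemma mean_descent (eta : R) X E W T : 0 <= eta ->
  mean_energy (fun i => W i + eta *: (be *: lapl (fun j => X j - E j) i + be^-1 *: T i))
  <= mean_energy W
   + eta * (be / 4 * (mean_sqr W / lam n)
            + (al + be) ^+ 2 / (be ^+ 5 * rho2) * mean_sqr T)
   + eta ^+ 2 * ((al + be) / (2 * be ^+ 3 * rho2) * mean_sqr T).
Proof.
move=> eta0; case/andP: lam_n_bounds => l2 lr.
have l0 : 0 < lam n by exact: lt_le_trans l2.
have h j := mean_mode_descent rho2_gt0 l2 be_gt0 be_al (avg W j 0) (avg T j 0) eta0.
have := @ler_sum R _ (index_enum 'I_d) xpredT _ _ (fun j _ => h j).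
rewrite !big_split /= -!mulr_sumr !big_split /= -!mulr_sumr -!mulr_suml.
rewrite /mean_energy /mean_sqr avgD avgZ avgD !avgZ avg_lapl scaler0 add0r.
have sqE (a : 'cV[R]_d) : \sum_j a j 0 ^+ 2 = dotp a a by [].
rewrite !sqE (_ : \sum_j (avg W j 0 + eta * (avg T j 0 / be)) ^+ 2
  = dotp (avg W + eta *: (be^-1 *: avg T)) (avg W + eta *: (be^-1 *: avg T))); last first.
  by apply: eq_bigr => j _; rewrite !mxE [be^-1 * _]mulrC expr2.
move: (dotp _ _) (dotp _ _) (dotp _ _) => s1 s2 s3 /(ler_wpM2l (ler0n R n)); lra.
Qed.

(** Each mode has four summands, whence the factor 4; in the consensus direction the Laplacian part
    vanishes and two remain. The coefficients are those of [kappa13] and [kappa14]. *)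
Lemma direction_bound X E W H (L : R) :
  modes_sqr H + mean_sqr H <= L ^+ 2 * modes_sqr X ->
  be ^+ 2 * rho <= al ^+ 2 * rho ^+ 2 ->
  \sum_i dotp (direction X E W H i) (direction X E W H i)
  <= 4 * (al ^+ 2 * rho ^+ 2 * modes_sqr E
    + (al ^+ 2 * rho ^+ 2 + L ^+ 2)
      * (modes_sqr X + (modes_sqr_div W + mean_sqr W / lam n))).
Proof.
move=> hH hbe; case/andP: lam_n_bounds => l2 lr.
have l0 : 0 < lam n by exact: lt_le_trans l2.
have r0 : 0 < rho by exact: lt_le_trans lr.
rewrite -modes_sqr_mean.
have m1 : modes_sqr (direction X E W H) <= 4 * (al ^+ 2 * rho ^+ 2 * modes_sqr X
   + al ^+ 2 * rho ^+ 2 * modes_sqr E + al ^+ 2 * rho ^+ 2 * modes_sqr_div W + modes_sqr H).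
  rewrite /modes_sqr /modes_sqr_div -!(sum2D, sum2Z).
  apply: ler_sum => l _; apply: ler_sum => j _; rewrite coord_direction.
  move: (coord Q X l j 0) (coord Q E l j 0) (coord Q W l j 0) (coord Q H l j 0) => a b c h.
  have q1 : (al * lam l.+2 * (a - b) + be * c + h) ^+ 2
     <= 4 * ((al * lam l.+2) ^+ 2 * a ^+ 2 + (al * lam l.+2) ^+ 2 * b ^+ 2
             + (be * c) ^+ 2 + h ^+ 2).
    move: (al * lam l.+2) (be * c) => s t; rewrite -subr_ge0.
    have -> : 4 * (s ^+ 2 * a ^+ 2 + s ^+ 2 * b ^+ 2 + t ^+ 2 + h ^+ 2)
      - (s * (a - b) + t + h) ^+ 2
      = (s * a + s * b) ^+ 2 + (s * a - t) ^+ 2 + (s * a - h) ^+ 2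
        + (s * b + t) ^+ 2 + (s * b + h) ^+ 2 + (t - h) ^+ 2 by ring.
    by rewrite !addr_ge0 ?sqr_ge0.
  apply: (le_trans q1); rewrite ler_pM2l // lerD2r.
  have q2 : (al * lam l.+2) ^+ 2 <= al ^+ 2 * rho ^+ 2.
    rewrite exprMn ler_pM2l ?exprn_gt0 //.
    by rewrite lerXn2r ?nnegrE ?(ltW r0) // ltW.
  have q3 : (be * c) ^+ 2 <= al ^+ 2 * rho ^+ 2 * (c ^+ 2 / lam l.+2).
    have -> : (be * c) ^+ 2 = be ^+ 2 * lam l.+2 * (c ^+ 2 / lam l.+2).
      by field; rewrite gt_eqF.
    apply: ler_wpM2r; first by rewrite divr_ge0 ?sqr_ge0 // ltW.
    by apply: le_trans hbe; rewrite ler_pM2l ?exprn_gt0.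
  by rewrite !lerD // ler_wpM2r ?sqr_ge0.
have m2 : mean_sqr (direction X E W H)
   <= 4 * (al ^+ 2 * rho ^+ 2 * (mean_sqr W / lam n)) + 4 * mean_sqr H.
  have r1 : mean_sqr (direction X E W H) <= 2 * be ^+ 2 * mean_sqr W + 2 * mean_sqr H.
    rewrite /mean_sqr avg_direction.
    move: (avg W) (avg H) => a b; have := dotpp_ge0 (be *: a - b).
    rewrite !(dotpDl, dotpDr, dotpNl, dotpNr, dotpZl, dotpZr) (dotpC b a).
    move=> /(mulr_ge0 (ler0n R n)); lra.
  have r2 : be ^+ 2 * mean_sqr W <= al ^+ 2 * rho ^+ 2 * (mean_sqr W / lam n).
    have -> : be ^+ 2 * mean_sqr W = be ^+ 2 * lam n * (mean_sqr W / lam n).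
      by field; rewrite gt_eqF.
    apply: ler_wpM2r; first by rewrite divr_ge0 ?mean_sqr_ge0 // ltW.
    by apply: le_trans hbe; rewrite ler_pM2l ?exprn_gt0.
  have r3 : 0 <= be ^+ 2 * mean_sqr W by rewrite mulr_ge0 ?sqr_ge0 ?mean_sqr_ge0.
  have := mean_sqr_ge0 H; lra.
have r4 : 0 <= L ^+ 2 * (modes_sqr_div W + mean_sqr W / lam n).
  rewrite mulr_ge0 ?sqr_ge0 // addr_ge0 ?modes_sqr_div_ge0 // divr_ge0 ?mean_sqr_ge0 //.
  exact: ltW.
have := modes_sqr_ge0 H; lra.
Qed.

Lemma modes_energy_ge X W :
  eps10 rho2 al be * (modes_sqr X + modes_sqr_div W) <= modes_energy X W.
Proof.
rewrite /modes_energy /modes_sqr /modes_sqr_div -!(sum2D, sum2Z).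
apply: ler_sum => l _; apply: ler_sum => j _.
exact: (mode_energy_ge rho2_gt0 (rho2_lam l) be_gt0 be_al).
Qed.

Lemma modes_energy_le X W :
  modes_energy X W <= eps11 rho2 al be * (modes_sqr X + modes_sqr_div W).
Proof.
rewrite /modes_energy /modes_sqr /modes_sqr_div -!(sum2D, sum2Z).
apply: ler_sum => l _; apply: ler_sum => j _.
apply: (le_trans (mode_energy_le rho2_gt0 (rho2_lam l) be_gt0 be_al _ _)).
rewrite mulrDr lerD // ler_wpM2r ?sqr_ge0 ?divr_ge0 ?sqr_ge0 ?(ltW (lam_gt0 l)) //.
  by rewrite /eps11 le_max lexx orbT.
by rewrite /eps11 le_max lexx.
Qed.


End Families.

(** * The iteration: recursions, energy descent and the joint invariant *)

Section Run.
Variables (R : realType) (n d : nat) (A : 'M[R]_n) (lam : nat -> R) (Q : 'M[R]_(n, n.-1)).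
Variables (f : 'I_n -> 'cV[R]_d -> R) (C : 'cV[R]_d -> 'cV[R]_d).
Variables (p phi Lf nu rho rho2 fstar alpha beta eta kappa1 kappa4 : R).
Variables (s : nat -> R) (x v xhat y q : 'I_n -> nat -> 'cV[R]_d) (xbar : nat -> 'cV[R]_d).
Hypotheses (hn : (2 <= n)%N) (hd : (0 < d)%N) (hA : weighted_graph A)
  (hspec : spectral_decomposition (laplacian A) lam Q).
Hypotheses (hrho2 : 0 < rho2) (rho2_lam : forall l : 'I_n.-1, rho2 <= lam l.+2)
  (lam_rho : forall l : 'I_n.-1, lam l.+2 <= rho).
Hypotheses (hLf : 0 < Lf) (hdiff : forall i z, differentiable (f i) z)
  (hlip : forall i a b, dotp (gradient (f i) a - gradient (f i) b)
     (gradient (f i) a - gradient (f i) b) <= Lf ^+ 2 * dotp (a - b) (a - b)).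
Hypotheses (hfstar : is_minimum (avg_fun f) fstar) (hnu : 0 < nu)
  (hPL : forall z, nu * (avg_fun f z - fstar)
     <= 2^-1 * dotp (gradient (avg_fun f) z) (gradient (avg_fun f) z)).
Hypotheses (hp : 1 <= p) (hphi : 0 < phi <= 1) (hC : compressor p phi C).
Hypotheses (hkappa4 : 0 < kappa4)
  (hkappa1 : Num.max ((9 + kappa4) / (2 * rho2)) 1 <= kappa1)
  (halpha : alpha = kappa1 * beta) (hbeta : kappa2 Lf rho2 kappa1 kappa4 < beta).
Hypotheses (eta_gt0 : 0 < eta)
  (eta_le : eta <= eps1_hat Lf rho2 alpha beta / (2 * eps2_hat Lf rho rho2 alpha beta))
  (eta_eps6 : eta * eps6 Lf rho2 alpha beta <= eps5 Lf rho2 alpha beta).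
Hypotheses (hxbar : forall k, xbar k = avg (fun i => x i k))
  (halg : algorithm (laplacian A) f C alpha beta eta s x v xhat y q).

Let n_gt0 : (0 < n)%N. Proof. exact: ltn_trans hn. Qed.
Let rho2_rho : rho2 <= rho.
Proof. by case/andP: (lam_n_bounds hn rho2_lam lam_rho); exact: le_trans. Qed.
Let b0 : 0 < beta. Proof. by eapply beta_gt0; try exact: hbeta; eassumption. Qed.
Let a0 : 0 < alpha. Proof. by eapply alpha_gt0; try exact: hbeta; eassumption. Qed.
Let b_le_a : beta <= alpha. Proof. by eapply beta_le_alpha; try exact: hbeta; eassumption. Qed.
Let b_lt_ar : beta < alpha * rho2. Proof. by eapply beta_alpha_rho2; try exact: hbeta; eassumption. Qed.
Let b_rho2 : 6 < beta * rho2. Proof. by eapply beta_rho2; try exact: hbeta; eassumption. Qed.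
Let e10_gt0 : 0 < eps10 rho2 alpha beta. Proof. by eapply eps10_gt0; try exact: hbeta; eassumption. Qed.
Let e11_gt0 : 0 < eps11 rho2 alpha beta. Proof. by eapply eps11_gt0; try exact: hbeta; eassumption. Qed.

Definition err k i : 'cV[R]_d := x i k - xhat i k.
Definition grad_bar k i : 'cV[R]_d := gradient (f i) (xbar k).
(** At a consensus fixed point [beta *: v i] cancels the gradient of [f i], so this shifted variable
    vanishes there. Taking the gradients at the average makes the shift change only with the mean
    step. *)
Definition dual k i : 'cV[R]_d := v i k + beta^-1 *: grad_bar k i.
Definition grad_gap k i : 'cV[R]_d := gradient (f i) (x i k) - grad_bar k i.
Definition grad_drift k i : 'cV[R]_d := eta^-1 *: (grad_bar k.+1 i - grad_bar k i).
Definition dir k : 'I_n -> 'cV[R]_d :=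
  direction A alpha beta (x^~ k) (err k) (dual k) (grad_gap k).

Definition lyapunov k : R :=
  modes_energy lam Q alpha beta (x^~ k) (dual k) + mean_energy lam alpha beta (dual k)
  + n%:R * (avg_fun f (xbar k) - fstar).

(** Both sequences accumulate the same [s k *: q i k], and [y] also loses its Laplacian; the
    difference thus accumulates the Laplacian of the increments of [xhat], from a zero start. *)
Lemma xhat_sub_y i k : xhat i k - y i k = lapl A (xhat^~ k) i.
Proof.
have step m : (Defs.prev (xhat i) m - Defs.prev (y i) m = lapl A (fun j => Defs.prev (xhat j) m) i) ->
    xhat i m - y i m = lapl A (xhat^~ m) i.
  move=> h; rewrite /lapl; under eq_bigr do rewrite (xhat_step halg) scalerDr.
  rewrite big_split /= -[X in _ = X + _]/(lapl A (fun j => Defs.prev (xhat j) m) i) -h.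
  have -> : \sum_j laplacian A i j *: (s m *: q j m)
      = s m *: \sum_j laplacian A i j *: q j m.
    by rewrite scaler_sumr; apply: eq_bigr => j _; rewrite !scalerA mulrC.
  have cancel (a b c e : 'cV[R]_d) : a + c - (b + c - e) = a - b + e.
    by apply/colP => r; rewrite !mxE; ring.
  by rewrite (xhat_step halg) (y_step halg) cancel.
elim: k => [|k IH]; apply: step => //=.
by rewrite subr0 /lapl big1 // => j _; rewrite scaler0.
Qed.

Lemma x_next i k : x i k.+1 = x i k - eta *: dir k i.
Proof.
rewrite (x_step halg) xhat_sub_y /dir /direction.
have -> : lapl A (fun j => x j k - err k j) i = lapl A (xhat^~ k) i.
  by apply: eq_bigr => j _; rewrite /err subKr.
rewrite /grad_gap /dual; apply/colP => r.
move: (lapl _ _ i) (grad_bar k i) (x i k) (v i k) (gradient _ (x i k)) => l g0 a b g.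
by rewrite !mxE; field; rewrite gt_eqF.
Qed.

Lemma dual_next k : dual k.+1 = (fun i => dual k i
  + eta *: (beta *: lapl A (fun j => x j k - err k j) i + beta^-1 *: grad_drift k i)).
Proof.
apply: funext => i; rewrite /dual /grad_drift (v_step halg) xhat_sub_y.
have -> : lapl A (fun j => x j k - err k j) i = lapl A (xhat^~ k) i.
  by apply: eq_bigr => j _; rewrite /err subKr.
apply/colP => r.
move: (lapl _ _ i) (grad_bar k.+1 i) (grad_bar k i) (v i k) => l g1 g0 b.
by rewrite !mxE; field; rewrite !gt_eqF.
Qed.

(** The columns of the Laplacian sum to zero. Consequently the mean of [dual] is the gradient of the
    objective over [beta], so the gradient term of the descent lemma can pay for it. *)
Lemma sum_v k : \sum_i v i k = 0.
Proof.
elim: k => [|k IH]; first by rewrite big1 // => i _; exact: v_init halg i.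
under eq_bigr do rewrite (v_step halg) xhat_sub_y.
by rewrite big_split /= IH add0r -scaler_sumr (sum_laplacian hn hA hspec) scaler0.
Qed.

Lemma avg_grad_bar k : avg (grad_bar k) = gradient (avg_fun f) (xbar k).
Proof. by rewrite gradient_avg_fun. Qed.

Lemma avg_dual k : avg (dual k) = beta^-1 *: gradient (avg_fun f) (xbar k).
Proof. by rewrite /dual avgD avgZ avg_grad_bar /avg sum_v scaler0 add0r. Qed.

Lemma avg_dir k : avg (dir k) = gradient (avg_fun f) (xbar k) + avg (grad_gap k).
Proof.
by rewrite /dir (avg_direction _ _ hn hA hspec) avg_dual scalerA mulfV ?gt_eqF // scale1r.
Qed.

Lemma xbar_next k : xbar k.+1 = xbar k - eta *: avg (dir k).
Proof.
rewrite !hxbar -avgZ -scaleN1r -avgZ -avgD; congr avg; apply: funext => i.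
by rewrite x_next scaleN1r.
Qed.

Lemma xbar_diff k : xbar k.+1 - xbar k = - (eta *: avg (dir k)).
Proof. by rewrite xbar_next addrAC subrr add0r. Qed.

Lemma grad_gap_bound k :
  modes_sqr Q (grad_gap k) + mean_sqr (grad_gap k) <= Lf ^+ 2 * modes_sqr Q (x^~ k).
Proof.
rewrite (modes_sqr_mean hn hspec) (modes_sqr_dev hn hspec) mulr_sumr.
by apply: ler_sum => i _; rewrite -hxbar; exact: hlip.
Qed.

Lemma grad_drift_bound k :
  modes_sqr Q (grad_drift k) + mean_sqr (grad_drift k) <= Lf ^+ 2 * mean_sqr (dir k).
Proof.
rewrite (modes_sqr_mean hn hspec).
apply: (@le_trans _ _ (\sum_(i < n) Lf ^+ 2 * dotp (avg (dir k)) (avg (dir k)))).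
  apply: ler_sum => i _; rewrite /grad_drift dotpZl dotpZr.
  have := hlip i (xbar k.+1) (xbar k).
  rewrite xbar_diff dotpNl dotpNr opprK dotpZl dotpZr.
  rewrite -/(grad_bar k.+1 i) -/(grad_bar k i) !mulrA -!expr2 => h.
  have e2 : 0 <= eta^-1 ^+ 2 by exact: sqr_ge0.
  have := ler_wpM2l e2 h; rewrite mulrA => /le_trans; apply.
  rewrite le_eqVlt; apply/orP; left; apply/eqP; field; rewrite gt_eqF //.
by rewrite sumr_const card_ord /mean_sqr -[_ *+ n]mulr_natl mulrCA.
Qed.

Lemma suboptimality_ge0 k : 0 <= n%:R * (avg_fun f (xbar k) - fstar).
Proof. by rewrite mulr_ge0 // subr_ge0; case: hfstar => _; apply. Qed.

(** Descent lemma and polarization: with [a] the mean direction and [g] the gradient, minus their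
    product is half of [|a - g|^2 - |a|^2 - |g|^2], and [a - g] is the mean of [grad_gap]. *)
Lemma suboptimality_descent k :
  n%:R * (avg_fun f (xbar k.+1) - fstar) <= n%:R * (avg_fun f (xbar k) - fstar)
   + eta * (- mean_sqr (grad_bar k) / 2 - mean_sqr (dir k) / 2 + mean_sqr (grad_gap k) / 2)
   + eta ^+ 2 * (Lf / 2 * mean_sqr (dir k)).
Proof.
have := descent_lemma (xbar k) (xbar k.+1) hLf (differentiable_avg_fun hdiff)
  (lipschitz_gradient_avg_fun n_gt0 hdiff hlip).
rewrite xbar_diff !dotpNr dotpNl opprK.
rewrite /mean_sqr avg_grad_bar.
have := avg_dir k; move: (avg (dir k)) (avg (grad_gap k)) (gradient _ _) => a h g e.
have gE : h = a - g by rewrite e addrC addKr.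
rewrite gE !(dotpDl, dotpDr, dotpNl, dotpNr, dotpZl, dotpZr) (dotpC g a).
move=> /(ler_wpM2l (ler0n R n)); lra.
Qed.

(** The constant 6 is the one in [kappa5], through [6 < beta * rho2 <= beta * lam n]. *)
Lemma mean_dual k :
  6 * beta * (mean_sqr (dual k) / lam n) <= mean_sqr (grad_bar k).
Proof.
case/andP: (lam_n_bounds hn rho2_lam lam_rho) => l2 lr.
have l0 : 0 < lam n by exact: lt_le_trans l2.
rewrite /mean_sqr avg_dual avg_grad_bar dotpZl dotpZr.
set G := dotp _ _.
have -> : 6 * beta * (n%:R * (beta^-1 * (beta^-1 * G)) / lam n)
    = n%:R * G * (6 / (beta * lam n)) by field; rewrite !gt_eqF.
rewrite ler_piMr ?mulr_ge0 ?dotpp_ge0 // ler_pdivrMr ?mulr_gt0 // mul1r.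
by rewrite (le_trans (ltW b_rho2)) // ler_pM2l.
Qed.

Lemma lyapunov_descent k :
  lyapunov k.+1 <= (1 - eta * kappa9 Lf nu rho2 alpha beta) * lyapunov k
   + eta * (eps8_tilde rho alpha beta + c7 rho alpha beta * eps1_hat Lf rho2 alpha beta
             / eps2_hat Lf rho rho2 alpha beta) * modes_sqr Q (err k).
Proof.
case/andP: (lam_n_bounds hn rho2_lam lam_rho) => l2 lr.
have l0 : 0 < lam n by exact: lt_le_trans l2.
have eta0 := ltW eta_gt0.
have hGF : 2 * nu * (n%:R * (avg_fun f (xbar k) - fstar)) <= mean_sqr (grad_bar k).
  rewrite /mean_sqr avg_grad_bar; have := ler_wpM2l (ler0n R n) (hPL (xbar k)); lra.
have ax : x^~ k.+1 = (fun i => x i k - eta *: dir k i) by apply: funext => i; rewrite x_next.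
have hV := modes_descent hspec hrho2 rho2_lam lam_rho b0 b_le_a b_lt_ar (x^~ k) (dual k)
  (err k) (grad_gap k) (grad_drift k) eta0.
rewrite -/(dir k) in hV; cbv beta in hV; rewrite -ax -dual_next in hV.
have hJ := mean_descent hn hA hspec hrho2 rho2_lam lam_rho b0 b_le_a (x^~ k) (err k)
  (dual k) (grad_drift k) eta0.
cbv beta in hJ; rewrite -dual_next in hJ.
have hF := suboptimality_descent k.
have hW0 : 0 <= mean_sqr (dual k) / lam n by rewrite divr_ge0 ?mean_sqr_ge0 // ltW.
have sd0 u := modes_sqr_div_ge0 (d := d) Q hrho2 rho2_lam u.
have := energy_descent hLf hrho2 rho2_rho hkappa4 hkappa1 halpha hbeta eta_gt0 eta_le eta_eps6
  (modes_sqr_ge0 _ _) (modes_sqr_ge0 _ _) (sd0 _)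
  (modes_sqr_ge0 _ _) (modes_sqr_ge0 _ _) hW0 (mean_sqr_ge0 _) (mean_sqr_ge0 _)
  (mean_sqr_ge0 _) (grad_gap_bound k) (grad_drift_bound k) (mean_dual k) hGF hV hJ hF.
move=> {hV hJ hF hGF ax} desc; rewrite /lyapunov.
apply: (le_trans desc); rewrite lerD2r => {desc}.
have u1 := modes_energy_le Q hrho2 rho2_lam b0 b_le_a (x^~ k) (dual k).
have u2 : mean_energy lam alpha beta (dual k)
    <= eps11 rho2 alpha beta * (mean_sqr (dual k) / lam n).
  rewrite /mean_energy ler_wpM2r // /eps11 le_max; apply/orP; left.
  have := ltW (divr_gt0 a0 b0); lra.
have F0 := suboptimality_ge0 k.
have u3 : n%:R * (avg_fun f (xbar k) - fstar)
    <= eps11 rho2 alpha beta * (n%:R * (avg_fun f (xbar k) - fstar)).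
  by rewrite ler_peMl //; eapply eps11_ge1; try exact: hbeta; eassumption.
(* The product [kappa9 * eps11] is below both dissipation rates, [eps1_hat / 2] and [nu / 2]. As
   [eps11 * (S + F)] dominates the energy, a fraction [kappa9] of the energy is dissipated per unit
   of [eta]. *)
have k9a : kappa9 Lf nu rho2 alpha beta * eps11 rho2 alpha beta
    <= eps1_hat Lf rho2 alpha beta / 2.
  have : kappa9 Lf nu rho2 alpha beta
      <= eps1_hat Lf rho2 alpha beta / (2 * eps11 rho2 alpha beta).
    by rewrite /kappa9 ge_min lexx.
  rewrite ler_pdivlMr ?mulr_gt0 //; lra.
have k9b : kappa9 Lf nu rho2 alpha beta * eps11 rho2 alpha beta <= nu / 2.
  have : kappa9 Lf nu rho2 alpha beta <= nu / (2 * eps11 rho2 alpha beta).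
    by rewrite /kappa9 ge_min lexx orbT.
  rewrite ler_pdivlMr ?mulr_gt0 //; lra.
have k9 : 0 < kappa9 Lf nu rho2 alpha beta by eapply kappa9_gt0; try exact: hbeta; eassumption.
set S := modes_sqr Q (x^~ k) + modes_sqr_div lam Q (dual k) + mean_sqr (dual k) / lam n.
set F := n%:R * _.
have S0 : 0 <= S by rewrite addr_ge0 ?addr_ge0 ?modes_sqr_ge0 ?sd0.
have u4 : kappa9 Lf nu rho2 alpha beta * lyapunov k
    <= eps1_hat Lf rho2 alpha beta / 2 * S + nu / 2 * F.
  have : lyapunov k <= eps11 rho2 alpha beta * (S + F).
    rewrite /lyapunov /S /F; move: u1 u2 u3; lra.
  move=> /(ler_wpM2l (ltW k9)) /le_trans; apply.
  rewrite mulrA mulrDr lerD //; exact: ler_wpM2r.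
have := ler_wpM2l eta0 u4; rewrite /lyapunov -/F; lra.
Qed.

Lemma lyapunov_ge k : eps10 rho2 alpha beta
   * (modes_sqr Q (x^~ k) + (modes_sqr_div lam Q (dual k) + mean_sqr (dual k) / lam n)
      + n%:R * (avg_fun f (xbar k) - fstar)) <= lyapunov k.
Proof.
case/andP: (lam_n_bounds hn rho2_lam lam_rho) => l2 lr.
have l0 : 0 < lam n by exact: lt_le_trans l2.
have u1 := modes_energy_ge Q hrho2 rho2_lam b0 b_le_a (x^~ k) (dual k).
have e1 : eps10 rho2 alpha beta <= 1 by eapply eps10_le1; try exact: hbeta; eassumption.
have hW0 : 0 <= mean_sqr (dual k) / lam n by rewrite divr_ge0 ?mean_sqr_ge0 // ltW.
have u2 : eps10 rho2 alpha beta * (mean_sqr (dual k) / lam n)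
    <= mean_energy lam alpha beta (dual k).
  rewrite /mean_energy ler_wpM2r // (le_trans e1) //.
  have : 1 <= alpha / beta by rewrite ler_pdivlMr // mul1r.
  lra.
have := ler_wpM2r (suboptimality_ge0 k) e1; rewrite /lyapunov; move: u1 u2; lra.
Qed.

Lemma lyapunov0_le : lyapunov 0 <= kappa8 alpha beta nu
    (kron (Kmx R n) (1%:M : 'M[R]_d)) (kron (Pmx lam Q) (1%:M : 'M[R]_d))
    (stack (fun i => x i 0%N)) (stack (fun i => v i 0%N))
    (stack (fun i => gradient (f i) (xbar 0%N)))
    (stack (fun _ : 'I_n => gradient (avg_fun f) (xbar 0%N))).
Proof.
have nu_inv : 0 < nu^-1 by rewrite invr_gt0.
have e : stack (fun i => v i 0%N) + beta^-1 *: stack (fun i => gradient (f i) (xbar 0%N))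
    = stack (dual 0).
  by apply/colP => r; rewrite /stack !mxE.
rewrite (kappa8E hn hspec alpha nu _ _ (lt0r_neq0 b0) e) /lyapunov /mean_energy.
rewrite lerD //.
  by rewrite /modes_energy /mean_sqr [n%:R * _ / _]mulrAC.
have h := ler_wpM2l (ltW nu_inv) (ler_wpM2l (ler0n R n) (hPL (xbar 0))).
have -> : n%:R * (avg_fun f (xbar 0) - fstar)
    = nu^-1 * (n%:R * (nu * (avg_fun f (xbar 0) - fstar))) by field; rewrite gt_eqF.
apply: (le_trans h); rewrite invfM le_eqVlt; apply/orP; left; apply/eqP; ring.
Qed.

(** Scaling by [s k] puts the innovation into the unit ball and rescales the absolute error
    [1 - phi]. As [prev] is 0 at the start, [q_init] is covered as well. *)
Lemma err_bound k : 0 < s k ->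
  (forall i, pnorm p (x i k - Defs.prev (xhat i) k) <= s k) ->
  forall i, pnorm p (err k i) <= (1 - phi) * s k.
Proof.
move=> sk h i; have p0 : 0 < p by exact: lt_le_trans hp.
pose z := (s k)^-1 *: (x i k - Defs.prev (xhat i) k).
have qE : q i k = C z.
  rewrite /z; case: (k) => [|m]; last exact: (q_step halg).
  by rewrite /= subr0; exact: (q_init halg).
have -> : err k i = - (s k *: (C z - z)).
  rewrite /err (xhat_step halg) qE scalerBr.
  have -> : s k *: z = x i k - Defs.prev (xhat i) k.
    by rewrite /z scalerA mulfV ?gt_eqF // scale1r.
  move: (s k *: _) (Defs.prev _ _) (x i k) => a b c.
  by apply/colP => r; rewrite !mxE; ring.
rewrite pnormN // pnormZ // gtr0_norm // mulrC ler_wpM2r ?(ltW sk) //.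
apply: hC; rewrite /z pnormZ // gtr0_norm ?invr_gt0 // mulrC ler_pdivrMr // mul1r.
exact: h.
Qed.

Lemma err_modes k (c : R) : 0 <= c -> (forall i, pnorm p (err k i) <= c) ->
  modes_sqr Q (err k) <= n%:R * dtilde d p ^+ 2 * c ^+ 2.
Proof.
move=> c0 h; rewrite modes_sqrE (le_trans (parseval_le hn hspec _)) //.
apply: (@le_trans _ _ (\sum_(i < n) dtilde d p ^+ 2 * c ^+ 2)).
  apply: ler_sum => i _; rewrite -enorm_sqr -exprMn.
  have dt0 : 0 <= dtilde d p by rewrite /dtilde; case: ifP => // _; exact: powR_ge0.
  rewrite lerXn2r ?nnegrE ?enorm_ge0 ?mulr_ge0 //.
  by rewrite (le_trans (enorm_le_dtilde _ hd hp)) // ler_wpM2l.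
by rewrite sumr_const card_ord -[_ *+ n]mulr_natl mulrA.
Qed.

(* Young's inequality with weight [phi], which the factor [(1 + phi) (1 - phi)^2 < 1]
   in [kappa12] leaves room for. *)
Lemma next_innovation k i :
  pnorm p (x i k.+1 - xhat i k) ^+ 2 <= (1 + phi) * pnorm p (err k i) ^+ 2
    + (1 + phi^-1) * (dhat d p ^+ 2 * (eta ^+ 2 * \sum_i dotp (dir k i) (dir k i))).
Proof.
have p0 : 0 < p by exact: lt_le_trans hp.
have phi0 : 0 < phi by case/andP: hphi.
have dh0 : 0 <= dhat d p by rewrite /dhat; case: ifP => // _; exact: powR_ge0.
have -> : x i k.+1 - xhat i k = err k i - eta *: dir k i.
  by rewrite x_next /err addrAC.
have h1 : pnorm p (err k i - eta *: dir k i)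
    <= pnorm p (err k i) + dhat d p * enorm (eta *: dir k i).
  by rewrite (le_trans (pnormD _ _ hp)) // lerD2l pnormN // pnorm_le_dhat.
have h2 : enorm (eta *: dir k i) ^+ 2 <= eta ^+ 2 * \sum_i dotp (dir k i) (dir k i).
  rewrite enorm_sqr dotpZl dotpZr mulrA -expr2 ler_wpM2l ?sqr_ge0 //.
  by rewrite (bigD1 i) //= lerDl sumr_ge0 // => m _; exact: dotpp_ge0.
have h3 : pnorm p (err k i - eta *: dir k i) ^+ 2
    <= (pnorm p (err k i) + dhat d p * enorm (eta *: dir k i)) ^+ 2.
  by rewrite lerXn2r // nnegrE ?pnorm_ge0 // addr_ge0 ?pnorm_ge0 ?mulr_ge0 ?enorm_ge0.
apply: (le_trans h3).
have h4 := ler_wpM2l (sqr_ge0 (dhat d p)) h2.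
have h5 : 0 <= 1 + phi^-1 by rewrite addr_ge0 // invr_ge0 ltW.
apply: (@le_trans _ _ ((1 + phi) * pnorm p (err k i) ^+ 2
   + (1 + phi^-1) * (dhat d p ^+ 2 * enorm (eta *: dir k i) ^+ 2))); last first.
  by rewrite lerD2l ler_wpM2l.
rewrite -exprMn; move: (pnorm _ _) (dhat _ _ * _) => a b.
rewrite -subr_ge0.
have -> : (1 + phi) * a ^+ 2 + (1 + phi^-1) * b ^+ 2 - (a + b) ^+ 2
    = phi * (a - b / phi) ^+ 2 by field; rewrite gt_eqF.
by rewrite mulr_ge0 ?sqr_ge0 // ltW.
Qed.

Variables (kappa7 gamma : R).
Hypotheses (s_gt0 : forall k, 0 < s k) (s_next : forall k, s k.+1 = gamma * s k)
  (gamma_ge0 : 0 <= gamma).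
Hypotheses
  (hkappa7 : kappa10 n d p Lf rho rho2 alpha beta * (1 - phi) ^+ 2
             / kappa9 Lf nu rho2 alpha beta < kappa7)
  (hkappa11 : kappa11 n d p phi Lf nu rho rho2 alpha beta eta kappa7 <= gamma ^+ 2)
  (hkappa12 : kappa12 n d p phi Lf rho rho2 alpha beta eta kappa7 <= gamma ^+ 2)
  (hlyapunov0 : lyapunov 0 <= kappa7 * s 0%N ^+ 2)
  (hx0 : forall i, pnorm p (x i 0%N) <= s 0%N).

Let kappa7_gt0 : 0 < kappa7.
Proof. by eapply kappa7_gt0; try exact: hbeta; try exact: hkappa7; eassumption. Qed.

Lemma err_modes_step k :
  (forall i, pnorm p (x i k - Defs.prev (xhat i) k) <= s k) ->
  modes_sqr Q (err k) <= n%:R * dtilde d p ^+ 2 * ((1 - phi) ^+ 2 * s k ^+ 2).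
Proof.
case/andP: hphi => phi0 phi1 h; rewrite -exprMn; apply: err_modes.
  by rewrite mulr_ge0 ?subr_ge0 // ltW.
exact: err_bound.
Qed.

Lemma lyapunov_step k :
  (forall i, pnorm p (x i k - Defs.prev (xhat i) k) <= s k) ->
  lyapunov k <= kappa7 * s k ^+ 2 -> lyapunov k.+1 <= kappa7 * s k.+1 ^+ 2.
Proof.
move=> hx hV; apply: (le_trans (lyapunov_descent k)).
set c := eps8_tilde _ _ _ + _.
have k9 : eta * kappa9 Lf nu rho2 alpha beta <= 1.
  eapply step_kappa9_le1; try exact: hbeta; try exact: eta_le; try eassumption.
  exact: ltW.
have c0 : 0 <= c by eapply kappa10_coef_ge0; try exact: hbeta; eassumption.
have h1 := ler_wpM2l c0 (err_modes_step hx).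
have h2 : (1 - eta * kappa9 Lf nu rho2 alpha beta) * lyapunov k
    <= (1 - eta * kappa9 Lf nu rho2 alpha beta) * (kappa7 * s k ^+ 2).
  by rewrite ler_wpM2l // subr_ge0.
have h3 := ler_wpM2l (mulr_ge0 (ltW kappa7_gt0) (sqr_ge0 (s k))) hkappa11.
rewrite s_next exprMn (mulrC (gamma ^+ 2)) mulrA; apply: le_trans h3.
(* An identity: the last term of [kappa11] is the compression error relative to [kappa7 * s k ^+ 2].
   The lower bound on [kappa7] is what makes [kappa11 < 1]. *)
have -> : kappa7 * s k ^+ 2 * kappa11 n d p phi Lf nu rho rho2 alpha beta eta kappa7
  = (1 - eta * kappa9 Lf nu rho2 alpha beta) * (kappa7 * s k ^+ 2)
    + eta * (c * (n%:R * dtilde d p ^+ 2 * ((1 - phi) ^+ 2 * s k ^+ 2))).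
  by rewrite /kappa11 /kappa10 -/c; field; rewrite gt_eqF.
by rewrite lerD // -mulrA ler_wpM2l // ltW.
Qed.

Lemma innovation_step k :
  (forall i, pnorm p (x i k - Defs.prev (xhat i) k) <= s k) ->
  lyapunov k <= kappa7 * s k ^+ 2 ->
  forall i, pnorm p (x i k.+1 - xhat i k) <= s k.+1.
Proof.
move=> hx hV i; have phi0 : 0 < phi by case/andP: hphi.
have s1 : 0 <= s k.+1 by exact: ltW.
rewrite -(@ler_pXn2r _ 2) ?nnegrE ?pnorm_ge0 //.
apply: (le_trans (next_innovation k i)).
have h1 : pnorm p (err k i) ^+ 2 <= (1 - phi) ^+ 2 * s k ^+ 2.
  have phi1 : 0 <= 1 - phi by rewrite subr_ge0; case/andP: hphi.
  by rewrite -exprMn lerXn2r ?nnegrE ?pnorm_ge0 ?err_bound // mulr_ge0 // ltW.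
have h2 := err_modes_step hx.
have hb : beta ^+ 2 * rho <= alpha ^+ 2 * rho ^+ 2.
  by eapply beta_alpha_rho; try exact: hbeta; eassumption.
have h3 := direction_bound hn hA hspec hrho2 rho2_lam lam_rho b0 b_le_a (err k) (dual k)
  (grad_gap_bound k) hb.
rewrite -/(dir k) in h3.
(* The state part of the direction is bounded by the energy over [eps10], the origin of that
   quotient in [kappa12]; the error part gives the [kappa13] term. *)
have h4 : modes_sqr Q (x^~ k) + (modes_sqr_div lam Q (dual k) + mean_sqr (dual k) / lam n)
    <= kappa7 * s k ^+ 2 / eps10 rho2 alpha beta.
  rewrite ler_pdivlMr // mulrC; apply: le_trans hV; apply: le_trans (lyapunov_ge k).
  by rewrite ler_pM2l // lerDl suboptimality_ge0.
have h5 := ler_wpM2r (sqr_ge0 (s k)) hkappa12.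
rewrite s_next exprMn; apply: le_trans h5.
move: h1 h2 h3 h4; rewrite /kappa12 /kappa13 /kappa14.
move: (pnorm _ _ ^+ 2) (modes_sqr Q (err k)) (\sum_i dotp _ _) (_ + (_ + _)) e10_gt0.
move: (eps10 _ _ _) (s k ^+ 2) (dhat d p) (dtilde d p) => e s2 dh dt a E D S e0 h1 h2 h3 h4.
have c1 : 0 <= 1 + phi^-1 by rewrite addr_ge0 // invr_ge0 ltW.
have h6 : D <= 4 * (alpha ^+ 2 * rho ^+ 2 * (n%:R * dt ^+ 2 * ((1 - phi) ^+ 2 * s2))
    + (alpha ^+ 2 * rho ^+ 2 + Lf ^+ 2) * (kappa7 * s2 / e)).
  apply: (le_trans h3); rewrite ler_pM2l // lerD // ler_wpM2l //.
    by rewrite mulr_ge0 ?sqr_ge0.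
  by rewrite addr_ge0 ?sqr_ge0 // mulr_ge0 ?sqr_ge0.
have h7 : (1 + phi) * a <= (1 + phi) * ((1 - phi) ^+ 2 * s2).
  by rewrite ler_wpM2l // addr_ge0 // ltW.
have h8 := ler_wpM2l c1 (ler_wpM2l (sqr_ge0 dh) (ler_wpM2l (sqr_ge0 eta) h6)).
apply: (le_trans (lerD h7 h8)); rewrite le_eqVlt; apply/orP; left; apply/eqP.
by field; rewrite !gt_eqF.
Qed.

Lemma invariant k : (forall i, pnorm p (x i k - Defs.prev (xhat i) k) <= s k)
  /\ lyapunov k <= kappa7 * s k ^+ 2.
Proof.
elim: k => [|k [hx hV]].
  by split; [move=> i; rewrite /= subr0; exact: hx0 | exact: hlyapunov0].
by split; [exact: innovation_step|exact: lyapunov_step].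
Qed.

Lemma gap_bound k :
  \sum_(i < n) (enorm (x i k - xbar k) ^+ 2 + avg_fun f (xbar k) - fstar)
    <= kappa7 / eps10 rho2 alpha beta * s k ^+ 2.
Proof.
have [_ hV] := invariant k.
rewrite mulrAC ler_pdivlMr //; apply: le_trans hV; apply: le_trans (lyapunov_ge k).
rewrite mulrC ler_pM2l //.
have -> : \sum_(i < n) (enorm (x i k - xbar k) ^+ 2 + avg_fun f (xbar k) - fstar)
    = modes_sqr Q (x^~ k) + n%:R * (avg_fun f (xbar k) - fstar).
  rewrite (modes_sqr_dev hn hspec) -hxbar.
  under eq_bigr do rewrite -addrA enorm_sqr.
  by rewrite big_split /= sumr_const card_ord -[_ *+ n]mulr_natl.
case/andP: (lam_n_bounds hn rho2_lam lam_rho) => l2 lr.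
have l0 : 0 < lam n by exact: lt_le_trans l2.
rewrite lerD2r lerDl addr_ge0 ?divr_ge0 ?mean_sqr_ge0 ?(ltW l0) //.
exact: modes_sqr_div_ge0 hrho2 rho2_lam _.
Qed.

End Run.

Theorem theorem7 (R : realType) (n d : nat) (hn : (2 <= n)%N) (hd : (0 < d)%N)
  (A : 'M[R]_n) (hA : weighted_graph A) (hconn : connected_graph A)
  (lam : nat -> R) (Q : 'M[R]_(n, n.-1))
  (hspec : spectral_decomposition (laplacian A) lam Q)
  (rho rho2 : R) (hrho : rho = spectral_radius (laplacian A))
  (hrho2 : rho2 = min_pos_eigenvalue (laplacian A))
  (f : 'I_n -> 'cV[R]_d -> R) (Lf : R) (hLf : 0 < Lf)
  (hdiff : forall i x, differentiable (f i) x)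
  (hlip : forall i x y,
     enorm (gradient (f i) x - gradient (f i) y) <= Lf * enorm (x - y))
  (fstar : R) (hfstar : is_minimum (avg_fun f) fstar)
  (nu : R) (hnu : 0 < nu)
  (hPL : forall x,
     nu * (avg_fun f x - fstar) <= 2^-1 * enorm (gradient (avg_fun f) x) ^+ 2)
  (p phi : R) (hp : 1 <= p) (hphi : 0 < phi <= 1)
  (C : 'cV[R]_d -> 'cV[R]_d) (hC : compressor p phi C)
  (kappa1 kappa4 kappa7 alpha beta eta s0 gamma : R)
  (hkappa4 : 0 < kappa4)
  (hkappa1 : Num.max ((9 + kappa4) / (2 * rho2)) 1 <= kappa1)
  (halpha : alpha = kappa1 * beta)
  (hbeta : kappa2 Lf rho2 kappa1 kappa4 < beta)
  (hkappa7 : kappa10 n d p Lf rho rho2 alpha beta * (1 - phi) ^+ 2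
             / kappa9 Lf nu rho2 alpha beta < kappa7)
  (heta : 0 < eta < kappa3_hat n d p phi Lf rho rho2 alpha beta kappa7)
  (hgamma : 0 < gamma < 1)
  (hgamma_ge :
     Num.max
       (Num.sqrt (kappa11 n d p phi Lf nu rho rho2 alpha beta eta kappa7))
       (Num.sqrt (kappa12 n d p phi Lf rho rho2 alpha beta eta kappa7))
     <= gamma)
  (x v xhat y q : 'I_n -> nat -> 'cV[R]_d)
  (xbar : nat -> 'cV[R]_d) (hxbar : forall k, xbar k = avg (fun i => x i k))
  (hs0 : 0 < s0)
  (hs0_ge :
     Num.max
       (Num.sqrt
          (kappa8 alpha beta nu
             (kron (Kmx R n) (1%:M : 'M[R]_d)) (kron (Pmx lam Q) (1%:M : 'M[R]_d))
             (stack (fun i => x i 0%N)) (stack (fun i => v i 0%N))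
             (stack (fun i => gradient (f i) (xbar 0%N)))
             (stack (fun _ : 'I_n => gradient (avg_fun f) (xbar 0%N)))
           / kappa7))
       (\big[Num.max/0]_(i < n) pnorm p (x i 0%N))
     <= s0)
  (halg : algorithm (laplacian A) f C alpha beta eta
            (fun k => s0 * gamma ^+ k) x v xhat y q) :
  exists M : R, forall k : nat,
    \sum_(i < n) (enorm (x i k - xbar k) ^+ 2 + avg_fun f (xbar k) - fstar)
      <= M * gamma ^+ k.
Proof.
have n0 : (0 < n)%N by exact: ltn_trans hn.
have r20 : 0 < rho2 by rewrite hrho2; apply: rho2_gt0 hspec.
have r2_lam (l : 'I_n.-1) : rho2 <= lam l.+2 by rewrite hrho2; apply: lam_ge_rho2 hspec _.
have lam_r (l : 'I_n.-1) : lam l.+2 <= rho by rewrite hrho; apply: lam_le_rho hspec _.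
have [r2_r l0] : rho2 <= rho /\ 0 < lam n.
  case/andP: (lam_n_bounds hn r2_lam lam_r) => h1 h2.
  by split; [exact: le_trans h2|exact: lt_le_trans h1].
have lip i a b : dotp (gradient (f i) a - gradient (f i) b)
    (gradient (f i) a - gradient (f i) b) <= Lf ^+ 2 * dotp (a - b) (a - b).
  by apply: enorm_le_sqr (hlip i a b); exact: ltW.
have PL z : nu * (avg_fun f z - fstar)
    <= 2^-1 * dotp (gradient (avg_fun f) z) (gradient (avg_fun f) z).
  by rewrite -enorm_sqr.
case/andP: heta => eta0; rewrite /kappa3_hat !lt_min => /and3P[eta1 eta2 _].
have eta3 : eta * eps6 Lf rho2 alpha beta <= eps5 Lf rho2 alpha beta.
  rewrite ltW // -ltr_pdivlMr //.
  by eapply eps6_gt0; try exact: hbeta; eassumption.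
case/andP: hgamma => g0 g1.
(* [Num.sqrt] is 0 on negative numbers, where the squared bound holds anyway. *)
have sqrt_le (a b : R) : 0 <= b -> Num.sqrt a <= b -> a <= b ^+ 2.
  move=> b0 h; have [a0|/ltW a0] := leP 0 a; last by rewrite (le_trans a0) ?sqr_ge0.
  by rewrite -(sqr_sqrtr a0) lerXn2r ?nnegrE ?sqrtr_ge0.
move: hgamma_ge; rewrite ge_max => /andP[/(sqrt_le _ _ (ltW g0)) k11 /(sqrt_le _ _ (ltW g0)) k12].
move: hs0_ge; rewrite ge_max => /andP[/(sqrt_le _ _ (ltW hs0)) k8 x0].
have k70 : 0 < kappa7.
  by eapply kappa7_gt0; try exact: hbeta; try exact: hkappa7; eassumption.
have lyap0 : lyapunov lam Q f fstar alpha beta x v xbar 0 <= kappa7 * (s0 * gamma ^+ 0) ^+ 2.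
  rewrite expr0 mulr1 mulrC -ler_pdivrMr //; apply: le_trans k8; rewrite ler_pM2r ?invr_gt0 //.
  by eapply lyapunov0_le; try exact: hbeta; eassumption.
have x0' i : pnorm p (x i 0%N) <= s0 * gamma ^+ 0.
  by rewrite expr0 mulr1 (le_trans _ x0) // le_bigmax.
have s_gt0 k : 0 < s0 * gamma ^+ k by rewrite mulr_gt0 ?exprn_gt0.
have s_next k : s0 * gamma ^+ k.+1 = gamma * (s0 * gamma ^+ k) by rewrite exprS mulrCA.
exists (kappa7 / eps10 rho2 alpha beta * s0 ^+ 2) => k.
apply: (le_trans (gap_bound hn hd hA hspec r20 r2_lam lam_r hLf hdiff lip hfstar hnu PL hp
  hphi hC hkappa4 hkappa1 halpha hbeta eta0 (ltW eta1) eta3 hxbar halg s_gt0 s_next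
  hkappa7 k11 k12 lyap0 x0' k)).
(* The bound obtained decays like [gamma ^+ (k * 2)]; it is weakened to [gamma ^+ k]. *)
rewrite exprMn mulrA -exprM ler_wpM2l //.
  rewrite mulr_ge0 ?sqr_ge0 // divr_ge0 ?(ltW k70) //.
  by apply: ltW; eapply eps10_gt0; try exact: hbeta; eassumption.
rewrite ler_wiXn2l ?(ltW g0) ?(ltW g1) // leq_pmulr //.
Qed.
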